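(* Let $\Omega=\mathbb{R}$ or $\Omega=\mathbb{T}$, let $k\ge 3$, let $\rho_2>\rho_1\ge 0$ be constants, and let $f_0\in H^k(\Omega)$. Let $T>0$ and let $f\in C^1([0,T];H^k(\Omega))$ be the solution of the one-dimensional interface equation $$ f_t(x,t)=\frac{\rho_2-\rho_1}{2\pi}\,PV\!\int_{\mathbb{R}}\frac{\big(\partial_x f(x,t)-\partial_x f(x-\alpha,t)\big)\alpha}{\alpha^2+\big(f(x,t)-f(x-\alpha,t)\big)^2}\,d\alpha,\qquad f(x,0)=f_0(x). $$ Then for all $t\in[0,T]$, $$\|f(\cdot,t)\|_{L^\infty(\Omega)}\le \|f_0\|_{L^\infty(\Omega)}.$$
   Context: $\mathbb{T}=\mathbb{R}/2\pi\mathbb{Z}$; in the periodic case $f(\cdot,t)$ is regarded as a $2\pi$-periodic function on $\mathbb{R}$ and the integral is still taken over $\mathbb{R}$. $PV$ denotes the principal value at infinity, i.e. $\lim_{R\to\infty}\int_{-R}^{R}$. $f$ describes the interface $x_2=f(x_1,t)$ between two incompressible fluids of densities $\rho_1$ (above) and $\rho_2$ (below) moving by Darcy's law (Muskat problem with equal viscosities). $H^k$ is the $L^2$-based Sobolev space. *)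

(* Defs.v *)
From HB Require Import structures.
From mathcomp Require Import all_boot all_order all_algebra.
From mathcomp Require Import all_classical all_reals all_analysis.
From mathcomp Require Export ess_sup_inf.
Set Implicit Arguments. Unset Strict Implicit. Unset Printing Implicit Defensive.
Import Order.TTheory GRing.Theory Num.Theory.
Import numFieldNormedType.Exports.
Local Open Scope classical_set_scope.
Local Open Scope ring_scope.

(* The two domains: Omega = R (Line) or Omega = T = R/2piZ (Torus).
   In the periodic case functions are 2pi-periodic functions on R. *)
Inductive domain := Line | Torus.

Section defs.
Variable R : realType.
Local Notation leb := (@lebesgue_measure R).

Definition dom_set (O : domain) : set R :=
  match O with Line => setT | Torus => `[0, 2 * pi]%classic end.

Definition dom_periodic (O : domain) (g : R -> R) : Prop :=
  match O with Line => True | Torus => forall x, g (x + 2 * pi) = g x end.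

Definition test_fun (phi : R -> R) : Prop :=
  (forall n x, derivable (derive1n n phi) x 1) /\
  exists M : R, forall x, M < `|x| -> phi x = 0.

Definition weak_deriv (g h : R -> R) : Prop :=
  forall phi, test_fun phi ->
    (\int[leb]_x (g x * derive1 phi x)%:E = - \int[leb]_x (h x * phi x)%:E)%E.

(* squared H^k norm of a function given with its chain of derivatives
   gs 0, gs 1, ..., gs k :  sum_{j<=k} || gs j ||_{L^2(Omega)}^2 *)
Definition Hk_normsq (O : domain) (k : nat) (gs : nat -> R -> R) : \bar R :=
  (\sum_(j < k.+1) \int[leb]_(x in dom_set O) ((gs j x) ^+ 2)%:E)%E.

Definition in_Hk (O : domain) (k : nat) (g : R -> R) (gs : nat -> R -> R) : Prop :=
  [/\ gs 0%N = g,
      forall j, (j <= k)%N -> measurable_fun setT (gs j) /\ dom_periodic O (gs j),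
      forall j, (j < k)%N -> weak_deriv (gs j) (gs j.+1)
    & (Hk_normsq O k gs < +oo)%E].

(* f (as a function x, t |-> f x t) is in C^1([0,T]; H^k(Omega)), with
   F t = derivative chain of f(.,t) and G t = derivative chain of the
   time derivative d/dt f(.,t) (an H^k-valued function). *)
Definition C1_Hk (O : domain) (k : nat) (T : R) (f : R -> R -> R)
    (F G : R -> nat -> R -> R) : Prop :=
  [/\ forall t, 0 <= t <= T -> in_Hk O k (fun x => f x t) (F t),
      forall t, 0 <= t <= T -> in_Hk O k (G t 0%N) (G t),
      forall t, 0 <= t <= T ->
        (fun s => Hk_normsq O k (fun j x => F s j x - F t j x))
          @ within [set s | 0 <= s <= T] (nbhs t) --> 0%E,
      forall t, 0 <= t <= T ->
        (fun h => Hk_normsq O k (fun j x => (F (t + h) j x - F t j x) / h - G t j x))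
          @ within [set h | 0 <= t + h <= T /\ h != 0] (nbhs 0) --> 0%E
    &
      forall t, 0 <= t <= T ->
        (fun s => Hk_normsq O k (fun j x => G s j x - G t j x))
          @ within [set s | 0 <= s <= T] (nbhs t) --> 0%E].

(* c * PV_{R->oo} int_{-R}^{R} of the Muskat kernel, at the point x and time t;
   fx is the x-derivative of f(.,t). *)
Definition muskat_pv_to (c : R) (g fx : R -> R) (x : R) (l : R) : Prop :=
  (fun M => c * Rintegral leb `[- M, M]%classic
     (fun a => (fx x - fx (x - a)) * a / (a ^+ 2 + (g x - g (x - a)) ^+ 2)))
    @ +oo%R --> l.

End defs.

(* Main.v *)
Require Import Defs.
From HB Require Import structures.
From mathcomp Require Import all_boot all_order all_algebra.
From mathcomp Require Import all_classical all_reals all_analysis.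
From mathcomp Require Import measurable_realfun.
From mathcomp Require Import ring lra.
Import Order.TTheory GRing.Theory Num.Theory.
Import numFieldNormedType.Exports.
Local Open Scope classical_set_scope.
Local Open Scope ring_scope.

Set Implicit Arguments. Unset Strict Implicit. Unset Printing Implicit Defensive.

(* Near-maximum version of the pointwise argument. At a point x where the
   profile v = f(.,t) is within d of its supremum the slope is small, and with
   D(a) = v(x) - v(x-a) >= -d one has
     (v'(x) - v'(x-a)) a / (a^2+D^2)
       = v'(x) a / (a^2+D^2) - (atan (D/a))' - D / (a^2+D^2),
   so every truncated integral, hence f_t(x,t), is at most a quantity that tends
   to 0 with d. Consequently S(t) = ess sup f(.,t), which is continuous in t,
   has nonpositive upper left Dini derivatives and is nonincreasing; the same
   holds for -f. Working with almost maximal points avoids the existence of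
   maximizers and treats the line and the torus alike. The regularity used
   (f(.,t) bounded with Lipschitz derivative, convergence in H^1 implying
   uniform convergence) follows from one-dimensional Sobolev embeddings, for
   which weak derivatives are first tested against smoothed indicators of
   intervals at Lebesgue points. *)

(** * Truncated principal values near a maximum *)

(** The bound must be uniform in the truncation radius [M]. Away from an exact maximum the slope
    [c0 = v1 x] need not vanish, the term [c0 * a / (a^2 + D^2)] decays only like [c0 / a], and each
    half of the integral may grow like a logarithm of [M]; the symmetric truncation cancels the two
    logarithms and the boundedness of [v] controls the remainder. In time, backward differences fit
    this: the nearly maximal point [x] is taken at the time [t] where the equation is used, and
    [f x (t - h) <= S (t - h)] comes for free. The threshold [d] may depend on [t], since a Dini
    derivative concerns one time only. All data are known almost everywhere, so the pointwise
    argument runs on continuous representatives, and nearly maximal points are picked inside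
    full-measure sets where the equation and the bound on the difference quotient hold. *)

Definition itv_integrable (R : realType) (g : R -> R) := forall a b : R,
  (@lebesgue_measure R).-integrable `[a, b] (EFin \o g).

Lemma Rintegral_itv_cat (R : realType) (h : R -> R) (a b c : R) : itv_integrable h ->
  a <= b -> b <= c -> \int[@lebesgue_measure R]_(y in `[a, c]) h y =
    \int[@lebesgue_measure R]_(y in `[a, b]) h y +
    \int[@lebesgue_measure R]_(y in `[b, c]) h y.
Proof.
move=> ih ab bc.
have := @Rintegral_itvB R h (BLeft a) (BRight c) b (ih a c).
rewrite !bnd_simp => /(_ ab bc); rewrite Rintegral_itv_obnd_cbnd; first lra.
by apply: integrableS (ih b c) => //; apply: subset_itvr; rewrite bnd_simp.
Qed.

Lemma lipschitz_ge0 (R : realType) (f : R -> R) (L : R) :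
  (forall y z, `|f y - f z| <= L * `|y - z|) -> 0 <= L.
Proof.
by move=> fL; have := fL 1 0; rewrite subr0 normr1 mulr1; apply: le_trans.
Qed.

Lemma continuous_itv_within (R : realType) (a b : R) (f : R -> R) :
  (forall x, a <= x <= b -> {for x, continuous f}) ->
  {within `[a, b], continuous f}.
Proof.
by move=> cf; apply: continuous_in_subspaceT => x /set_mem/=; rewrite in_itv; exact: cf.
Qed.

Lemma continuous_itv_integrable (R : realType) (a b : R) (f : R -> R) :
  (forall x, a <= x <= b -> {for x, continuous f}) ->
  (@lebesgue_measure R).-integrable `[a, b] (EFin \o f).
Proof.
move=> cf; apply: continuous_compact_integrable; first exact: segment_compact.
exact: continuous_itv_within.
Qed.

Lemma is_derive_continuous (R : realType) (f : R -> R) (x a : R) :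
  is_derive x 1 f a -> {for x, continuous f}.
Proof. by case=> /derivable1_diffP/differentiable_continuous. Qed.

Lemma Rintegral_primitive (R : realType) (a b : R) (dp p : R -> R) :
  a < b ->
  (forall x, a <= x <= b -> {for x, continuous dp}) ->
  (forall x, a <= x <= b -> is_derive x 1 p (dp x)) ->
  \int[@lebesgue_measure R]_(x in `[a, b]) dp x = p b - p a.
Proof.
move=> ab cdp dpp.
have cp x : a <= x <= b -> {for x, continuous p}.
  by move=> /dpp; exact: is_derive_continuous.
rewrite /Rintegral (@continuous_FTC2 _ dp p)//; first exact: continuous_itv_within.
  split => [x||]; last 2 first.
  - by apply: cvg_at_right_filter; apply: cp; rewrite lexx ltW.
  - by apply: cvg_at_left_filter; apply: cp; rewrite lexx ltW.
  by rewrite in_itv/= => /andP[ax xb]; case: (dpp x) => //; rewrite !ltW.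
move=> x; rewrite in_itv/= => /andP[ax xb].
by rewrite derive1E; have := dpp x; rewrite !ltW// => /(_ isT) dx; rewrite derive_val.
Qed.

Lemma le_Rintegral_primitive (R : realType) (a b : R) (q dp p : R -> R) :
  a < b ->
  (forall x, a <= x <= b -> {for x, continuous q}) ->
  (forall x, a <= x <= b -> {for x, continuous dp}) ->
  (forall x, a <= x <= b -> is_derive x 1 p (dp x)) ->
  (forall x, a <= x <= b -> q x <= dp x) ->
  \int[@lebesgue_measure R]_(x in `[a, b]) q x <= p b - p a.
Proof.
move=> ab cq cdp dpp qdp; rewrite -(Rintegral_primitive ab cdp dpp).
by apply: le_Rintegral => //; exact: continuous_itv_integrable.
Qed.

Lemma atan_le_id (R : realType) (x : R) : 0 <= x -> atan x <= x.
Proof.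
move=> x0.
suff : 0 - atan 0 <= x - atan x by rewrite atan0 subr0; lra.
have d (y : R) : is_derive y 1 (fun z : R => z - atan z) (1 - (1 + y ^+ 2)^-1).
  exact: (@is_deriveB _ _ _ id (@atan R)).
apply: (@ger0_derive1_ndecry R (fun z => z - atan z) 0) => // [y _|].
  rewrite derive1E derive_val subr_ge0 invf_le1; last by rewrite ltr_wpDr ?sqr_ge0.
  by rewrite lerDl sqr_ge0.
apply: continuous_subspaceT => y.
by have [/derivable1_diffP/differentiable_continuous] := d y.
Qed.

Section pointwise_derivatives.
Variables (R : realType) (x : R).
Implicit Types f g : R -> R.

Lemma is_derive1D f g a b : is_derive x 1 f a -> is_derive x 1 g b ->
  is_derive x 1 (fun y => f y + g y) (a + b).
Proof. exact: is_deriveD. Qed.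

Lemma is_derive1N f a : is_derive x 1 f a -> is_derive x 1 (fun y => - f y) (- a).
Proof. exact: is_deriveN. Qed.

Lemma is_derive1M f g a b : is_derive x 1 f a -> is_derive x 1 g b ->
  is_derive x 1 (fun y => f y * g y) (a * g x + f x * b).
Proof.
move=> fa gb; apply: (is_derive_eq (is_deriveM fa gb)).
by rewrite /GRing.scale/= addrC (mulrC a).
Qed.

Lemma is_derive1V f a : f x != 0 -> is_derive x 1 f a ->
  is_derive x 1 (fun y => (f y)^-1) (- a / f x ^+ 2).
Proof.
move=> f0 fa; apply: (is_derive_eq (is_deriveV f0 fa)).
by rewrite /GRing.scale/= !mulNr mulrC.
Qed.

End pointwise_derivatives.

Section kernel.
Variable R : realType.
Local Notation leb := (@lebesgue_measure R).

Definition muskat_kernel (v v1 : R -> R) (x a : R) :=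
  (v1 x - v1 (x - a)) * a / (a ^+ 2 + (v x - v (x - a)) ^+ 2).

Lemma muskat_kernel_measurable (v v1 : R -> R) x :
  measurable_fun [set: R] v -> measurable_fun [set: R] v1 ->
  measurable_fun [set: R] (muskat_kernel v v1 x).
Proof.
move=> mv mv1.
have mx : measurable_fun [set: R] (fun a : R => x - a) by exact: measurable_funB.
have mv1x : measurable_fun [set: R] (fun a : R => v1 (x - a)) := measurableT_comp mv1 mx.
have mvx : measurable_fun [set: R] (fun a : R => v (x - a)) := measurableT_comp mv mx.
have md : measurable_fun [set: R] (fun a : R => a ^+ 2 + (v x - v (x - a)) ^+ 2).
  by apply: measurable_funD; apply: measurable_funX => //; exact: measurable_funB.
(* no measurability lemma for [^-1] is available, but the denominator is
   nonnegative and [powR] is measurable *)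
rewrite (_ : muskat_kernel v v1 x = fun a =>
    ((v1 x - v1 (x - a)) * a) * (a ^+ 2 + (v x - v (x - a)) ^+ 2) `^ (-1)).
  apply: measurable_funM; first by apply: measurable_funM => //; exact: measurable_funB.
  exact: (measurableT_comp (measurable_powR (-1))).
by apply/funext => a; rewrite powR_inv1// addr_ge0// sqr_ge0.
Qed.

Variables (v v1 : R -> R) (B L : R).
Hypothesis dv : forall y : R, is_derive y 1 v (v1 y).
Hypothesis v1L : forall y z, `|v1 y - v1 z| <= L * `|y - z|.

Lemma lipschitz_continuous1 : continuous v1.
Proof.
have L0 := lipschitz_ge0 v1L.
move=> x; apply/cvgrPdist_le => e e0; near=> y.
rewrite (le_trans (v1L _ _))//.
(* [L + 1] keeps the divisor positive when [L = 0]. *)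
have : `|x - y| <= e / (L + 1).
  near: y; apply: cvgr_dist_le => //; rewrite divr_gt0//; lra.
rewrite ler_pdivlMr; last lra.
have := normr_ge0 (x - y); nra.
Unshelve. all: by end_near. Qed.

Lemma lipschitz_taylor x s : `|v (x + s) - v x - v1 x * s| <= L * s ^+ 2.
Proof.
have cv : continuous v by move=> y; exact: (is_derive_continuous (dv y)).
(* The expansion point [w] is left free in [[y, z]]: the left endpoint serves [s >= 0], the right
   one [s < 0]. *)
have key y z : y <= z -> forall w, y <= w <= z ->
    `|v z - v y - v1 w * (z - y)| <= L * (z - y) ^+ 2.
  move=> yz w ywz.
  have [c] := MVT_segment yz (fun y _ => dv y) (continuous_subspaceT cv).
  rewrite in_itv/= => yc ->; rewrite -mulrBl normrM (ger0_norm (_ : 0 <= z - y)) ?subr_ge0//.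
  rewrite expr2 mulrA ler_wpM2r ?subr_ge0// (le_trans (v1L _ _))//.
  have L0 := lipschitz_ge0 v1L.
  apply: ler_wpM2l => //; rewrite ler_norml; lra.
have [s0|s0] := leP 0 s.
  have := key x (x + s) _ x.
  by rewrite (_ : x + s - x = s); [apply; lra|ring].
have := key (x + s) x _ x.
rewrite (_ : x - (x + s) = - s); last ring.
rewrite sqrrN (_ : v x - _ - _ = - (v (x + s) - v x - v1 x * s)); last ring.
by rewrite normrN; apply; lra.
Qed.

Lemma muskat_kernel_continuous x (a : R) : a != 0 -> {for a, continuous (muskat_kernel v v1 x)}.
Proof.
move=> a0.
have cv1 : {for a, continuous (fun a : R => v1 (x - a))}.
  apply: continuous_comp; last exact: lipschitz_continuous1.
  by apply: cvgB; [exact: cvg_cst|exact: cvg_id].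
have cv : {for a, continuous (fun a : R => v (x - a))}.
  apply: continuous_comp; last exact: is_derive_continuous (dv _).
  by apply: cvgB; [exact: cvg_cst|exact: cvg_id].
have cX (f : R -> R) : {for a, continuous f} -> {for a, continuous (fun a => f a ^+ 2)}.
  by move=> cf; exact: (continuous_comp cf (@exprn_continuous R 2 (f a))).
apply: cvgM.
  by apply: cvgM; [apply: cvgB; [exact: cvg_cst|exact: cv1]|exact: cvg_id].
apply: cvgV; first by rewrite gt_eqF// ltr_pwDl ?sqr_ge0// exprn_even_gt0.
apply: cvgD; first exact: (cX id cvg_id).
by apply: (cX (fun a => v x - v (x - a))); apply: cvgB; [exact: cvg_cst|exact: cv].
Qed.

(** The Lipschitz bound on [v1] yields a second factor [|a|] in the numerator, and [a^2] is at most
    the denominator. Hence there is no singularity at [a = 0], and the principal value concerns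
    infinity only. *)
Lemma muskat_kernel_bound x a : `|muskat_kernel v v1 x a| <= L.
Proof.
have L0 := lipschitz_ge0 v1L.
have [->|a0] := eqVneq a 0; first by rewrite /muskat_kernel mulr0 mul0r normr0.
have a20 : 0 < a ^+ 2 by rewrite exprn_even_gt0.
rewrite normrM normfV (ger0_norm (addr_ge0 (sqr_ge0 _) (sqr_ge0 _))).
rewrite ler_pdivrMr; last by rewrite ltr_pwDl ?sqr_ge0.
rewrite normrM; have := v1L x (x - a); rewrite subKr => h.
rewrite (le_trans (ler_wpM2r (normr_ge0 a) h))//.
by rewrite -mulrA -expr2 real_normK ?num_real// ler_wpM2l// lerDl sqr_ge0.
Qed.

Lemma lebesgue_measure_itv_lty (a b : R) : (leb `[a, b]%classic < +oo)%E.
Proof. by rewrite lebesgue_measure_itv/=; case: ifP => // _; rewrite -EFinB ltry. Qed.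

Lemma muskat_kernel_integrable x (a b : R) :
  leb.-integrable `[a, b] (EFin \o muskat_kernel v v1 x).
Proof.
apply: measurable_bounded_integrable => //.
- exact: lebesgue_measure_itv_lty.
- apply: (@measurable_funS _ _ _ _ setT) => //; apply: muskat_kernel_measurable.
    by apply: continuous_measurable_fun => y; exact: is_derive_continuous (dv y).
  by apply: continuous_measurable_fun; exact: lipschitz_continuous1.
- exists L; split; first exact: num_real.
  by move=> K LK y _ /=; rewrite (le_trans (muskat_kernel_bound x y))// ltW.
Qed.

Section at_point.
Variables (x d : R).
Hypothesis vB : forall y, `|v x - v y| <= B.
Hypothesis vd : forall y, v y <= v x + d.

Let c0 := v1 x.

(* [p] below is an antiderivative of an upper bound of the kernel:
   [- v1(x-a) a / (a^2+D^2) = - (atan (D/a))' - D / (a^2+D^2)], with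
   [D = v x - v (x-a) >= - d], while [v1 x * a / (a^2+D^2)] is compared with
   [v1 x / a], whose contributions on both sides of [0] cancel. *)
Lemma muskat_kernel_right_le (e M : R) : 0 < e -> e < M ->
  \int[leb]_(a in `[e, M]) muskat_kernel v v1 x a <=
  c0 * (ln M - ln e) + (`|c0| + L * e + d / e + `|c0| * B ^+ 2 / e ^+ 2).
Proof.
move=> e0 eM.
have d0 : 0 <= d by have := vd x; lra.
have L0 := lipschitz_ge0 v1L.
pose D a := v x - v (x - a).
have dD (a : R) : is_derive a 1 D (v1 (x - a)).
  have : is_derive a 1 (fun a : R => v x - (v \o (fun a : R => x - a)) a)
      (0 - (v1 (x - a) * (0 - 1))).
    exact: is_derive1D.
  by move=> h; apply: (is_derive_eq h); ring.
have DB a : D a ^+ 2 <= B ^+ 2.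
  by rewrite -(real_normK (num_real (D a))) ler_sqr ?nnegrE//; [exact: vB|exact: le_trans (vB x)].
have Dd a : - d <= D a by rewrite /D; have := vd (x - a); lra.
(* With [Q = a^2 + D^2], replacing [c0 * a / Q] by [c0 / a] leaves [- c0 * D^2 / (a * Q)], which the
   derivative of the last term dominates; [- D / Q] is dominated by [d / a^2], the derivative of
   [- d / a]. *)
pose p a := c0 * ln a - atan (D a / a) - d / a - `|c0| * B ^+ 2 / a ^+ 2.
pose dp a := c0 / a - (v1 (x - a) * a - D a) / (a ^+ 2 + D a ^+ 2) + d / a ^+ 2 +
   2 * (`|c0| * B ^+ 2) / a ^+ 3.
have dpp (a : R) : e <= a <= M -> is_derive a 1 p (dp a).
  move=> /andP[ea aM]; have a0 : 0 < a by lra.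
  have an0 : a != 0 by rewrite gt_eqF.
  have h1 : is_derive a 1 (fun a : R => c0 * ln a) (0 * ln a + c0 * a^-1).
    by apply: is_derive1M; exact: is_derive1_ln.
  have hV : is_derive a 1 (fun a : R => a^-1) (- 1 / a ^+ 2).
    by apply: is_derive1V => //; exact: is_derive_id.
  have h2 : is_derive a 1 (@atan R \o (fun a : R => D a / a))
      ((1 + (D a / a) ^+ 2)^-1 * (v1 (x - a) / a + D a * (- 1 / a ^+ 2))).
    by apply: is_derive1_comp; exact: is_derive1M.
  have h3 : is_derive a 1 (fun a : R => d / a) (0 / a + d * (- 1 / a ^+ 2)).
    exact: is_derive1M.
  have h4 : is_derive a 1 (fun a : R => `|c0| * B ^+ 2 / a ^+ 2)
     (0 / a ^+ 2 + `|c0| * B ^+ 2 * (- ((2%:R * a ^+ 1) *: 1) / (a ^+ 2) ^+ 2)).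
    apply: is_derive1M; apply: is_derive1V; first by rewrite expf_neq0.
    by apply: (@is_deriveX _ _ id 2); exact: is_derive_id.
  have := is_derive1D (is_derive1D (is_derive1D h1
    (is_derive1N h2)) (is_derive1N h3)) (is_derive1N h4).
  move=> h; apply: (is_derive_eq h); rewrite /dp /GRing.scale/=; field.
  by rewrite an0/= gt_eqF//= ltr_pwDl ?exprn_gt0 ?sqr_ge0.
have cV (f : R -> R) (a : R) : f a != 0 -> {for a, continuous f} ->
    {for a, continuous (fun a : R => (f a)^-1)}.
  by move=> fa cf; apply: cvgV.
have cD (a : R) : {for a, continuous D} := is_derive_continuous (dD a).
have cv1 (a : R) : {for a, continuous (fun a : R => v1 (x - a))}.
  apply: continuous_comp; last exact: lipschitz_continuous1.
  by apply: cvgB; [exact: cvg_cst|exact: cvg_id].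
have cid (a : R) : {for a, continuous (fun a : R => a)} by exact: cvg_id.
have cX (f : R -> R) n (a : R) : {for a, continuous f} ->
    {for a, continuous (fun a : R => (f a) ^+ n)}.
  by move=> cf; exact: (continuous_comp cf (@exprn_continuous R n (f a))).
have den (a : R) : e <= a -> 0 < a ^+ 2 + D a ^+ 2.
  by move=> ea; rewrite ltr_pwDl ?exprn_gt0 ?sqr_ge0//; lra.
have cden (a : R) : e <= a -> {for a, continuous (fun a : R => (a ^+ 2 + D a ^+ 2)^-1)}.
  move=> ea; apply: cV; first by rewrite gt_eqF// den.
  by apply: cvgD; exact: cX.
have ckern (a : R) : e <= a <= M -> {for a, continuous (muskat_kernel v v1 x)}.
  by move=> /andP[ea _]; apply: muskat_kernel_continuous; rewrite gt_eqF//; lra.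
have cdp (a : R) : e <= a <= M -> {for a, continuous dp}.
  move=> /andP[ea _]; have an0 : a != 0 by rewrite gt_eqF//; lra.
  apply: cvgD.
    apply: cvgD.
      apply: cvgB; first by apply: cvgM; [exact: cvg_cst|exact: (cV id)].
      apply: cvgM; last exact: cden.
      apply: cvgB; last exact: cD.
      by apply: cvgM => //; exact: (cv1 a).
    apply: cvgM; first exact: cvg_cst.
    by apply: (cV (fun a => a ^+ _)); [rewrite expf_neq0|exact: (cX id)].
  apply: cvgM; first exact: cvg_cst.
    by apply: (cV (fun a => a ^+ _)); [rewrite expf_neq0|exact: (cX id)].
apply: le_trans (le_Rintegral_primitive eM ckern cdp dpp _) _.
  move=> a /andP[ea _]; have a0 : 0 < a by lra.
  rewrite /muskat_kernel -/c0 -/(D a) /dp.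
  set Q := a ^+ 2 + D a ^+ 2.
  have Q0 : 0 < Q by exact: den.
  have aQ : a ^+ 2 <= Q by rewrite lerDl sqr_ge0.
  have -> : (c0 - v1 (x - a)) * a / Q = c0 / a - (v1 (x - a) * a - D a) / Q
     - D a / Q - c0 * D a ^+ 2 / (a * Q).
    by rewrite /Q; field; rewrite ?gt_eqF.
  have h1 : - (D a / Q) <= d / a ^+ 2.
    rewrite -mulNr ler_pdivrMr// mulrAC ler_pdivlMr ?exprn_gt0//.
    rewrite (le_trans (_ : _ <= d * a ^+ 2))//.
      by rewrite ler_wpM2r ?sqr_ge0//; have := Dd a; lra.
    exact: ler_wpM2l.
  have h2 : - (c0 * D a ^+ 2 / (a * Q)) <= 2 * (`|c0| * B ^+ 2) / a ^+ 3.
    rewrite -!mulNr ler_pdivrMr ?mulr_gt0// mulrAC ler_pdivlMr ?exprn_gt0//.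
    have hc : - c0 <= `|c0| by rewrite lerNl lerNnormlW.
    rewrite (le_trans (_ : _ <= `|c0| * B ^+ 2 * a ^+ 3))//.
      apply: ler_wpM2r; first by rewrite exprn_ge0// ltW.
      rewrite (le_trans (_ : _ <= `|c0| * D a ^+ 2))// ?ler_wpM2r ?sqr_ge0//.
      by rewrite ler_wpM2l.
    rewrite (_ : 2 * _ * (a * Q) = (`|c0| * B ^+ 2) * (2 * (a * Q))); last ring.
    apply: ler_wpM2l; first by apply: mulr_ge0 => //; exact: sqr_ge0.
    have -> : a ^+ 3 = a * a ^+ 2 by ring.
    nra.
  lra.
(* This is offset exactly by the term [- d / M] of [p M], so that [M] survives only in [ln M]. *)
have hM : - atan (D M / M) <= d / M.
  rewrite -atanN (le_trans _ (atan_le_id _))//; last by rewrite divr_ge0//; lra.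
  by apply: le_atan; rewrite -mulNr ler_wpM2r ?invr_ge0//; [lra|have := Dd M; lra].
(* Near [0] the quotient [D e / e] is close to the slope [c0], by the Taylor bound at [- e]. *)
have he : atan (D e / e) <= `|c0| + L * e.
  rewrite (le_trans _ (atan_le_id _))//; last by rewrite addr_ge0// mulr_ge0//; lra.
  apply: le_atan; rewrite ler_pdivrMr//.
  have := lipschitz_taylor x (- e); rewrite ler_norml => /andP[+ _].
  rewrite -/c0 /D sqrrN; have := ler_norm c0; nra.
have h3 : 0 <= `|c0| * B ^+ 2 / M ^+ 2.
  by rewrite divr_ge0 ?sqr_ge0//; apply: mulr_ge0 => //; exact: sqr_ge0.
rewrite /p; lra.
Qed.

End at_point.
End kernel.

Section kernel_near_maximum.
Variable R : realType.
Local Notation leb := (@lebesgue_measure R).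
Variables (v v1 : R -> R) (B L : R).
Hypothesis dv : forall y : R, is_derive y 1 v (v1 y).
Hypothesis v1L : forall y z, `|v1 y - v1 z| <= L * `|y - z|.

Section at_point.
Variables (x d : R).
Hypothesis vB : forall y, `|v x - v y| <= B.
Hypothesis vd : forall y, v y <= v x + d.

(** Reflection: the left half for [v] at [x] is the right half for [y |-> v (- y)] at [- x]. The
    slope changes sign there, so the logarithm comes with the sign opposite to that of the right
    half. *)
Lemma muskat_kernel_left_le (e M : R) : 0 < e -> e < M ->
  \int[leb]_(a in `[- M, - e]) muskat_kernel v v1 x a <=
  - v1 x * (ln M - ln e) + (`|v1 x| + L * e + d / e + `|v1 x| * B ^+ 2 / e ^+ 2).
Proof.
move=> e0 eM.
rewrite /Rintegral integration_by_substitution_oppr; last 2 first.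
- exact: ltW.
- apply: continuous_in_subspaceT => a /set_mem/=; rewrite in_itv/= => /andP[_ ae].
  by apply: (muskat_kernel_continuous dv v1L); rewrite lt_eqF//; lra.
pose w y := v (- y); pose w1 y := - v1 (- y).
have dw (y : R) : is_derive y 1 w (w1 y).
  have : is_derive y 1 (v \o -%R) (v1 (- y) * - 1).
    by apply: is_derive1_comp; exact: is_derive1N.
  by move=> h; apply: (is_derive_eq h); rewrite /w1; ring.
have w1L y z : `|w1 y - w1 z| <= L * `|y - z|.
  by rewrite /w1 opprK addrC (le_trans (v1L _ _))// opprK addrC.
have := @muskat_kernel_right_le R w w1 B L dw w1L (- x) d _ _ e M e0 eM.
rewrite /w1 /w opprK normrN; move/(_ (fun y => vB (- y)) (fun y => vd (- y))).
rewrite (_ : Rintegral _ _ _ = Rintegral leb `[e, M] (muskat_kernel v v1 x \o -%R))//.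
apply: eq_Rintegral => a _; rewrite /muskat_kernel/= !opprK opprB sqrrN.
have -> : a - - x = x + a by ring.
by congr (_ / _); ring.
Qed.

(** The logarithms of the two sides cancel, which removes [M] from the bound. Of [4 * L * e], half
    comes from [[- e, e]], where the kernel is at most [L], and half from the two sides. *)
Lemma muskat_kernel_le (e M : R) : 0 < e -> e < M ->
  \int[leb]_(a in `[- M, M]) muskat_kernel v v1 x a <=
  4 * L * e + 2 * (`|v1 x| + d / e + `|v1 x| * B ^+ 2 / e ^+ 2).
Proof.
move=> e0 eM; pose q := muskat_kernel v v1 x.
have qi : itv_integrable q := muskat_kernel_integrable dv v1L x.
rewrite (@Rintegral_itv_cat _ _ _ (- e) _ qi); [|lra|lra].
rewrite (@Rintegral_itv_cat _ _ (- e) e _ qi); [|lra|lra].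
have mid : \int[leb]_(y in `[- e, e]) q y <= 2 * L * e.
  have -> : 2 * L * e = \int[leb]_(y in `[- e, e]) L.
    rewrite Rintegral_cst//= lebesgue_measure_itv/= lte_fin ifT; last lra.
    by rewrite -EFinB/=; ring.
  apply: le_Rintegral => //.
    apply: continuous_compact_integrable; first exact: segment_compact.
    by apply: continuous_subspaceT => ?; exact: cvg_cst.
  by move=> y _; exact: le_trans (ler_norm _) (muskat_kernel_bound _ v1L x y).
have := muskat_kernel_left_le e0 eM; have := muskat_kernel_right_le dv v1L vB vd e0 eM.
by rewrite -/q mulNr; lra.
Qed.

End at_point.

(** A step of length [r] in the uphill direction raises [v] by at least [|v1 x| * r - L * r^2], yet
    by no more than [d]. *)
Lemma slope_near_maximum x d r : 0 < r -> (forall y, v y <= v x + d) ->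
  `|v1 x| <= d / r + L * r.
Proof.
move=> r0 vd.
have h s : v1 x * s <= d + L * s ^+ 2.
  have := lipschitz_taylor dv v1L x s; rewrite ler_norml => /andP[+ _].
  by have := vd (x + s); lra.
rewrite -(ler_pM2r r0) mulrDl divfK ?gt_eqF// -mulrA -expr2.
have := h r; have := h (- r); rewrite sqrrN.
by have [v0|v0] := leP 0 (v1 x); [rewrite ger0_norm//|rewrite ltr0_norm//]; lra.
Qed.

(** The quantifier order matters: [e] and [d] are fixed before the point [x] and the radius [M]. *)
Lemma muskat_kernel_near_max_le (eta : R) : 0 <= B -> 0 < eta ->
  (forall y z, `|v y - v z| <= B) ->
  exists e d, [/\ 0 < e, 0 < d & forall x M, (forall y, v y <= v x + d) -> e < M ->
    \int[leb]_(a in `[- M, M]) muskat_kernel v v1 x a <= eta].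
Proof.
move=> B0 eta0 vB.
have L0 := lipschitz_ge0 v1L.
(* Each choice uses the previous ones: [e] makes [4 * L * e <= eta / 4]; [p] is the slope allowed by
   [2 * p * K <= eta / 4]; [r] gives [L * r <= p / 2]; finally [d] gives both [d / r <= p / 2] and
   [2 * d / e <= eta / 4]. *)
pose e := eta / (16 * (L + 1)).
have e0 : 0 < e by rewrite divr_gt0//; lra.
have eE : e * (16 * (L + 1)) = eta by rewrite divfK// gt_eqF//; lra.
pose K := 1 + B ^+ 2 / e ^+ 2.
have K1 : 1 <= K by rewrite lerDl divr_ge0 ?sqr_ge0.
pose p := eta / (8 * K).
have p0 : 0 < p by rewrite divr_gt0//; lra.
have pE : p * (8 * K) = eta by rewrite divfK// gt_eqF//; lra.
pose r := p / (2 * (L + 1)).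
have r0 : 0 < r by rewrite divr_gt0//; lra.
have rE : r * (2 * (L + 1)) = p by rewrite divfK// gt_eqF//; lra.
pose d := Num.min (p * r / 2) (eta * e / 8).
have d0 : 0 < d.
  by rewrite lt_min; apply/andP; split; (apply: divr_gt0; [exact: mulr_gt0|lra]).
exists e, d; split => // x M vd eM.
have := muskat_kernel_le (vB x) vd e0 eM.
have h1 : `|v1 x| <= p.
  have := slope_near_maximum r0 vd.
  have : d / r <= p / 2.
    rewrite ler_pdivrMr//; have h : d <= p * r / 2 by rewrite /d ge_min lexx.
    by lra.
  lra.
have h2 : d / e <= eta / 8.
  rewrite ler_pdivrMr//; have h : d <= eta * e / 8 by rewrite /d ge_min lexx orbT.
  by lra.
have h3 : `|v1 x| * K <= p * K by rewrite ler_wpM2r//; lra.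
have h4 : `|v1 x| * K = `|v1 x| + `|v1 x| * B ^+ 2 / e ^+ 2 by rewrite /K; ring.
lra.
Qed.

End kernel_near_maximum.

(** * A smooth step function *)

Section smooth_functions.
Variable R : realType.
Implicit Types f g : R -> R.

(** Differentiability of order [n + 1]. Recursing on [derive1 f] lets closure under sums, products
    and inverses go by induction on [n]. *)
Fixpoint diff_class (n : nat) f : Prop :=
  (forall x : R, derivable f x 1) /\ if n is m.+1 then diff_class m (derive1 f) else True.

Lemma diff_class_derivable n f : diff_class n f -> forall x : R, derivable f x 1.
Proof. by case: n => [|n] []. Qed.

Lemma diff_classS n f : diff_class n.+1 f -> diff_class n f.
Proof.
elim: n f => [|n IH] f; first by case=> df _; split.
by move=> [df H]; split => //; exact: IH.
Qed.

Lemma diff_classP f : (forall n, diff_class n f) ->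
  forall n (x : R), derivable (derive1n n f) x 1.
Proof.
move=> H n; elim: n f H => [|n IH] f H x; first exact: (diff_class_derivable (H 0%N)).
by rewrite derive1Sn; apply: IH => m; case: (H m.+1).
Qed.

Lemma derive1_eq f f' : (forall x : R, is_derive x 1 f (f' x)) -> (derive1 f) = f'.
Proof. by move=> H; apply/funext => x; rewrite derive1E; have h := H x; rewrite derive_val. Qed.

Lemma diff_classI n f f' : (forall x : R, is_derive x 1 f (f' x)) ->
  diff_class n f' -> diff_class n.+1 f.
Proof.
by move=> df H; split; [move=> x; exact: (@ex_derive _ _ _ _ _ _ _ (df x))|rewrite (derive1_eq df)].
Qed.

Lemma diff_class_is_derive n f : diff_class n f ->
  forall x : R, is_derive x 1 f ((derive1 f) x).
Proof.
by move=> /diff_class_derivable df x; rewrite derive1E; exact/derivableP.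
Qed.

Lemma diff_class_cst n (c : R) : diff_class n (fun=> c).
Proof.
elim: n c => [|n IH] c; first by split => // x; exact: derivable_cst.
by apply: (@diff_classI _ _ (fun=> 0)) => // x; exact: is_derive_cst.
Qed.

Lemma diff_classD n f g : diff_class n f -> diff_class n g ->
  diff_class n (fun x => f x + g x).
Proof.
elim: n f g => [|n IH] f g Hf Hg.
  split => // x; have := diff_class_is_derive Hf x; have := diff_class_is_derive Hg x.
  by move=> hg hf; exact: (@ex_derive _ _ _ _ _ _ _ (is_derive1D hf hg)).
apply: (@diff_classI _ _ (fun x => (derive1 f) x + (derive1 g) x)).
  by move=> x; apply: is_derive1D; apply: diff_class_is_derive; [exact: Hf|exact: Hg].
by apply: IH; [case: Hf|case: Hg].
Qed.

Lemma diff_classM n f g : diff_class n f -> diff_class n g ->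
  diff_class n (fun x => f x * g x).
Proof.
elim: n f g => [|n IH] f g Hf Hg.
  split => // x; have := diff_class_is_derive Hf x; have := diff_class_is_derive Hg x.
  by move=> hg hf; exact: (@ex_derive _ _ _ _ _ _ _ (is_derive1M hf hg)).
apply: (@diff_classI _ _ (fun x => (derive1 f) x * g x + f x * (derive1 g) x)).
  by move=> x; apply: is_derive1M; apply: diff_class_is_derive; [exact: Hf|exact: Hg].
by apply: diff_classD; apply: IH; [case: Hf|exact: diff_classS|exact: diff_classS|case: Hg].
Qed.

Lemma diff_classV n f : (forall x, f x != 0) -> diff_class n f ->
  diff_class n (fun x => (f x)^-1).
Proof.
move=> f0; elim: n f f0 => [|n IH] f f0 Hf.
  split => // x; have hf := diff_class_is_derive Hf x.
  exact: (@ex_derive _ _ _ _ _ _ _ (is_derive1V (f0 x) hf)).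
(* The derivative is written as a product containing [(f x)^-1] itself, so that the induction
   hypothesis applies to it. *)
apply: (@diff_classI _ _ (fun x => (- 1) * (derive1 f) x * ((f x)^-1 * (f x)^-1))).
  move=> x; have hf := diff_class_is_derive Hf x.
  by apply: (is_derive_eq (is_derive1V (f0 x) hf)); field.
apply: diff_classM; first by apply: diff_classM; [exact: diff_class_cst|case: Hf].
by apply: diff_classM; apply: IH => //; exact: diff_classS.
Qed.

Lemma diff_class_affine n f (s c : R) : diff_class n f ->
  diff_class n (fun x => f (s * x + c)).
Proof.
have da (x : R) : is_derive x 1 (fun x : R => s * x + c) s.
  have : is_derive x 1 (fun x : R => s * x + c) ((0 * x + s * 1) + 0).
    by apply: is_derive1D; apply: is_derive1M.
  by move=> h; apply: (is_derive_eq h); ring.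
have dc g (x : R) : (forall y : R, derivable g y 1) ->
    is_derive x 1 (fun x => g (s * x + c)) (s * (derive1 g) (s * x + c)).
  move=> dg; rewrite mulrC; apply: (@is_derive1_comp _ g (fun x => s * x + c)).
  by rewrite derive1E; exact/derivableP.
elim: n f => [|n IH] f Hf.
  split => // x; exact: (@ex_derive _ _ _ _ _ _ _ (dc _ x (diff_class_derivable Hf))).
apply: (@diff_classI _ _ (fun x => s * (derive1 f) (s * x + c))).
  by move=> x; apply: dc; exact: diff_class_derivable Hf.
by apply: diff_classM; [exact: diff_class_cst|apply: IH; case: Hf].
Qed.

(** The classical flat function [exp (- 1 / x)], weighted by [x^-k] so that the family is closed, up
    to linear combinations, under differentiation. *)
Definition flat (k : nat) (x : R) : R := if 0 < x then x ^- k * expR (- x^-1) else 0.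

(** With [K = k + 1], [exp (1 / x)] is the [K]-th power of [exp (1 / (K * x)) >= 1 / (K * x)], which
    beats [x^-k] with one power of [x] to spare. *)
Lemma flat_bound k x : `|flat k x| <= k.+1%:R ^+ k.+1 * `|x|.
Proof.
rewrite /flat; case: ifPn => [x0|_]; last by rewrite normr0 mulr_ge0// exprn_ge0.
have x0' := ltW x0; rewrite !ger0_norm ?mulr_ge0 ?expR_ge0 ?invr_ge0 ?exprn_ge0//.
rewrite expRN ler_pdivrMr ?expR_gt0// -(ler_pM2l (x := x ^+ k)) ?exprn_gt0//.
rewrite mulfV ?gt_eqF ?exprn_gt0//.
set K : R := k.+1%:R; have K0 : 0 < K by rewrite ltr0n.
have -> : x ^+ k * (K ^+ k.+1 * x * expR x^-1) = (K * x) ^+ k.+1 * expR x^-1.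
  by rewrite exprMn [x ^+ k.+1]exprSr; ring.
have -> : expR x^-1 = expR (K * x)^-1 ^+ k.+1.
  by rewrite -expRM_natl; congr expR; rewrite -/K; field; rewrite !gt_eqF.
rewrite -exprMn exprn_ege1// -ler_pdivrMl ?mulr_gt0// mulr1.
by rewrite (le_trans _ (expR_ge1Dx _))// lerDr.
Qed.

Lemma is_derive_flat k (x : R) :
  is_derive x 1 (flat k) (- k%:R * flat k.+1 x + flat k.+2 x).
Proof.
have [x0|x0|<-] := ltgtP 0 x.
- have xn0 : x != 0 by rewrite gt_eqF.
  have : is_derive x 1 (fun y : R => y ^- k * expR (- y^-1))
     (- (k%:R * x ^+ k.-1 *: 1) / (x ^+ k) ^+ 2 * expR (- x^-1) +
      x ^- k * (expR (- x^-1) * - (- 1 / x ^+ 2))).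
    apply: is_derive1M.
      apply: is_derive1V; first by rewrite expf_neq0.
      by have := @is_deriveX _ _ id k x 1 1 _; rewrite exprfctE; apply.
    apply: (@is_derive1_comp _ expR (fun y => - y^-1)).
    by apply: is_derive1N; apply: is_derive1V.
  move=> h; rewrite /flat x0.
  apply: (@near_eq_is_derive _ _ _ (fun y : R => y ^- k * expR (- y^-1))).
    by near=> y; rewrite ifT//; near: y; exact: lt_nbhsr.
  apply: (is_derive_eq h); rewrite /GRing.scale/=.
  case: k {h} => [|k]; first by field.
  rewrite -pred_Sn !exprS; field.
  by rewrite xn0 expf_neq0.
- rewrite /flat ltNge ltW//= mulr0 addr0.
  apply: (@near_eq_is_derive _ _ _ (fun=> 0)).
  by near=> y; rewrite ifF//; apply/negbTE; rewrite -leNgt ltW//; near: y; exact: lt_nbhsl.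
rewrite /flat ltxx mulr0 addr0.
(* At [0] the difference quotient of [flat k] is [flat k.+1], which vanishes linearly by
   [flat_bound]. *)
have H : h^-1 *: (flat k (h + 0) - flat k 0) @[h --> (0:R)^'] --> (0 : R).
  apply: (@cvg_to_0_linear _ _ (k.+2%:R ^+ k.+2) 1) => // h /andP[h0 _].
  have hn0 : h != 0 by rewrite -normr_gt0.
  rewrite addr0 [flat k 0]/flat ltxx subr0.
  have -> : h^-1 *: flat k h = flat k.+1 h.
    by rewrite /flat /GRing.scale/=; case: ifP => _; rewrite ?mulr0// exprS invfM mulrA.
  exact: flat_bound.
apply: DeriveDef.
  by apply/cvg_ex; exists 0; move: H; under eq_fun do rewrite -[X in X + 0]mulr1.
rewrite /derive; apply/cvg_lim => //.
by move: H; under eq_fun do rewrite -[X in X + 0]mulr1.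
Unshelve. all: by end_near. Qed.

Lemma diff_class_flat n k : diff_class n (flat k).
Proof.
elim: n k => [|n IH] k.
  by split => // x; exact: (@ex_derive _ _ _ _ _ _ _ (is_derive_flat k x)).
apply: (diff_classI (@is_derive_flat k)); apply: diff_classD => //.
by apply: diff_classM => //; exact: diff_class_cst.
Qed.

Lemma smooth_step : exists theta : R -> R,
  [/\ forall n, diff_class n theta, forall x, x <= 0 -> theta x = 0,
      forall x, 1 <= x -> theta x = 1, forall x, 0 <= theta x <= 1 &
      (forall x, x < 0 \/ 1 < x -> derive1 theta x = 0) /\
      exists K, forall x, `|derive1 theta x| <= K].
Proof.
have flat_ge0 x : 0 <= flat 0 x.
  by rewrite /flat; case: ifP => // _; rewrite mulr_ge0// ?expR_ge0// invr_ge0 expr0.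
have flat_gt0 x : 0 < x -> 0 < flat 0 x.
  by move=> x0; rewrite /flat x0 expr0 invr1 mul1r expR_gt0.
have flat_le0 x : x <= 0 -> flat 0 x = 0 by rewrite leNgt /flat => /negbTE ->.
(* [x] and [1 - x] are never both nonpositive, so the denominator is positive everywhere. *)
pose den (x : R) := flat 0 x + flat 0 (- 1 * x + 1).
have den0 x : 0 < den x.
  rewrite /den; have [x0|x0] := ltP 0 x; first by rewrite ltr_pwDl// flat_gt0.
  by rewrite ltr_wpDl// flat_gt0//; lra.
pose theta (x : R) := flat 0 x * (den x)^-1.
have t0 x : x <= 0 -> theta x = 0 by move=> x0; rewrite /theta flat_le0// mul0r.
have t1 x : 1 <= x -> theta x = 1.
  move=> x1; rewrite /theta /den (flat_le0 (- 1 * x + 1)); last lra.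
  by rewrite addr0 divff// gt_eqF// flat_gt0//; lra.
have smooth n : diff_class n theta.
  apply: diff_classM; first exact: diff_class_flat.
  apply: diff_classV; first by move=> x; rewrite gt_eqF.
  apply: diff_classD; first exact: diff_class_flat.
  by apply: diff_class_affine; exact: diff_class_flat.
exists theta; split => //.
  move=> x; rewrite divr_ge0 ?(ltW (den0 x))//= ler_pdivrMr// mul1r lerDl flat_ge0//.
have loc a (y : R) : (\forall z \near y, theta z = a) -> (derive1 theta) y = 0.
  move=> ya; rewrite derive1E.
  have h : is_derive y 1 theta 0.
    by apply: (@near_eq_is_derive _ _ _ (fun=> a)); apply: filterS ya => z ->.
  by rewrite derive_val.
have out x : x < 0 \/ 1 < x -> derive1 theta x = 0.
  move=> [x0|x1].
    by apply: (loc 0); near=> z; apply: t0; rewrite ltW//; near: z; exact: lt_nbhsl.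
  by apply: (loc 1); near=> z; apply: t1; rewrite ltW//; near: z; exact: lt_nbhsr.
split => //.
(* The derivative is continuous and vanishes outside [[0, 1]], so its maximum there is a global
   bound. *)
have ct : continuous (fun x => `|(derive1 theta) x|).
  move=> x; apply: cvg_norm; have [_ [d _]] := smooth 1%N.
  by have /derivable1_diffP/differentiable_continuous := d x.
have [c _ cmax] := EVT_max ler01 (continuous_subspaceT ct).
exists `|(derive1 theta) c| => x.
have [x0|x0] := ltP x 0; first by rewrite out ?normr0//; left.
have [x1|x1] := ltP 1 x; first by rewrite out ?normr0//; right.
by apply: cmax; rewrite in_itv/= x0.
Unshelve. all: by end_near. Qed.

End smooth_functions.

(** * Weak derivatives and primitives *)

Section weak_derivative.
Variable R : realType.
Local Notation leb := (@lebesgue_measure R).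
Implicit Types g h : R -> R.

Lemma Rintegral_support (D A : set R) g : A `<=` D ->
  (forall x, D x -> ~ A x -> g x = 0) ->
  \int[leb]_(x in D) g x = \int[leb]_(x in A) g x.
Proof.
move=> AD g0; rewrite Rintegral_mkcond [RHS]Rintegral_mkcond.
apply: eq_Rintegral => x _; rewrite !patchE.
have [xA|xA] := boolP (x \in A); first by rewrite (mem_set (AD _ (set_mem xA))).
case: ifPn => // /set_mem xD; apply: g0 => //.
by move=> /mem_set; apply/negP.
Qed.

Lemma itv_integrableM g (p : R -> R) (a b K : R) :
  itv_integrable g -> measurable_fun [set: R] p -> (forall x, `|p x| <= K) ->
  leb.-integrable `[a, b] (EFin \o (fun x => g x * p x)).
Proof.
move=> ig mp pK; have := ig a b.
move=> /integrableMl -/(_ _ p); apply => //; first exact: measurable_funS mp.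
exists K; split; first exact: num_real.
by move=> M KM y _ /=; rewrite (le_trans (pK y))// ltW.
Qed.

Lemma itv_integrable_dist g (c a b : R) : itv_integrable g ->
  leb.-integrable `[a, b] (EFin \o (fun x => `|g x - c|)).
Proof.
move=> ig; have ih : leb.-integrable `[a, b] (EFin \o (fun x => g x - c)).
  have ic : leb.-integrable `[a, b] (EFin \o cst c).
    by apply: continuous_itv_integrable => ? _; exact: cvg_cst.
  by have /(_ ltac:(by [])) := integrableB _ (ig a b) ic.
exact: (integrable_norm ih).
Qed.

(** [lebesgue_pt] speaks of averages over centred open balls. The interval [[a, a + r]] lies in the
    ball of radius [2 * r], whose measure [4 * r] explains [e / 4]. *)
Lemma lebesgue_pt_right g a : measurable_fun [set: R] g -> itv_integrable g -> lebesgue_pt g a ->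
  forall e, 0 < e -> exists2 r0, 0 < r0 & forall r, 0 < r < r0 ->
    \int[leb]_(x in `[a, a + r]) `|g x - g a| <= e * r.
Proof.
move=> mg ig lp e e0.
have [d /= d0 H] : \forall r \near (0 : R)^'+, (davg g a r < (e / 4)%:E)%E.
  have nb : nbhs (0%E : \bar R) [set y | (y < (e / 4)%:E)%E].
    apply: open_nbhs_nbhs; split; first exact: open_ereal_lt_ereal.
    by rewrite /= lte_fin divr_gt0.
  exact: (lp _ nb).
exists (d / 2); first by rewrite divr_gt0.
move=> r /andP[r0 rd].
have r20 : 0 < 2 * r by lra.
have ball_r : ball (0 : R) d (2 * r).
  by rewrite /ball/= sub0r normrN ger0_norm; lra.
have := H (2 * r) ball_r r20.
rewrite /davg /iavg (lebesgue_measure_ball _ (ltW r20)) inver ifF; last first.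
  by apply/negbTE; rewrite mulrn_eq0/= gt_eqF.
have sub : `[a, a + r] `<=` ball a (2 * r).
  move=> x/=; rewrite in_itv/= => /andP[ax xr].
  by rewrite /ball/= distrC ger0_norm; lra.
rewrite muleC -lte_pdivlMr ?invr_gt0 ?pmulrn_lgt0// => lt.
rewrite -lee_fin /Rintegral fineK; last first.
  by apply: integrable_fin_num => //; exact: itv_integrable_dist.
apply: le_trans (_ : _ <= \int[leb]_(y in ball a (2 * r)) `|((center (g a) \o g) y)%:E|)%E _.
  apply: ge0_subset_integral => //; first exact: measurable_ball.
  apply: measurableT_comp => //; apply: measurableT_comp => //.
  by apply: measurable_funB => //; exact: measurable_funS mg.
apply: le_trans (ltW lt) _; rewrite lee_fin.
by rewrite invrK -mulr_natr; lra.
Qed.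

Section cutoff.
Variables (theta : R -> R) (K : R).
Hypothesis theta_smooth : forall n, diff_class n theta.
Hypothesis theta_le0 : forall x, x <= 0 -> theta x = 0.
Hypothesis theta_ge1 : forall x, 1 <= x -> theta x = 1.
Hypothesis theta01 : forall x, 0 <= theta x <= 1.
Hypothesis dtheta0 : forall x, x < 0 \/ 1 < x -> derive1 theta x = 0.
Hypothesis dthetaK : forall x, `|derive1 theta x| <= K.

(** The step is rescaled to rise on [[a, a + N^-1]]; its derivative [dramp] is an approximate Dirac
    mass at the right of [a]. *)
Let ramp (N a x : R) := theta (N * x + - (N * a)).
Let dramp (N a x : R) := N * derive1 theta (N * x + - (N * a)).

Let ramp_smooth N a n : diff_class n (ramp N a).
Proof. exact: diff_class_affine. Qed.

Let is_derive_ramp N a (x : R) : is_derive x 1 (ramp N a) (dramp N a x).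
Proof.
have da : is_derive x 1 (fun x : R => N * x + - (N * a)) N.
  have : is_derive x 1 (fun x : R => N * x + - (N * a)) ((0 * x + N * 1) + 0).
    by apply: is_derive1D; apply: is_derive1M.
  by move=> h; apply: (is_derive_eq h); ring.
rewrite /dramp mulrC; apply: (@is_derive1_comp _ theta (fun x => N * x + - (N * a))).
exact: diff_class_is_derive (theta_smooth 0%N) _.
Qed.

Let dramp_continuous N a : continuous (dramp N a).
Proof.
move=> x; have [_ H] := ramp_smooth N a 1%N.
rewrite -(derive1_eq (is_derive_ramp N a)).
exact: (is_derive_continuous (@diff_class_is_derive _ 0 _ H x)).
Qed.

Let ramp_continuous N a : continuous (ramp N a).
Proof. by move=> x; exact: is_derive_continuous (is_derive_ramp N a x). Qed.

Let dramp_bound N a x : 0 < N -> `|dramp N a x| <= N * K.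
Proof. by move=> N0; rewrite normrM (gtr0_norm N0) ler_pM2l. Qed.

(** [dramp N a] has integral [1] over [[a, a + N^-1]] and size at most [N * K], so the error is at
    most [N * K] times the integral of [|g - g a|], itself at most [e / N] at a Lebesgue point. *)
Lemma approx_delta g a : measurable_fun [set: R] g -> itv_integrable g ->
  lebesgue_pt g a -> forall e, 0 < e -> exists2 r0, 0 < r0 &
  forall N, 0 < N -> N^-1 < r0 ->
    `|\int[leb]_(x in `[a, a + N^-1]) (g x * dramp N a x) - g a| <= K * e.
Proof.
move=> mg ig lp e e0; have [r0 r00 H] := lebesgue_pt_right mg ig lp e0.
exists r0 => // N N0 Nr0; set r := N^-1; have rp : 0 < r by rewrite invr_gt0.
have Nr : N * r = 1 by rewrite divff// gt_eqF.
have c1 : \int[leb]_(x in `[a, a + r]) dramp N a x = 1.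
  have aar : a < a + r by rewrite ltrDl.
  rewrite (Rintegral_primitive aar (fun x _ => @dramp_continuous N a x)
    (fun x _ => is_derive_ramp N a x)).
  rewrite /ramp theta_ge1 ?theta_le0 ?subr0//; first by rewrite subrr.
  by rewrite mulrDr Nr; lra.
have md : measurable_fun [set: R] (dramp N a).
  by apply: continuous_measurable_fun; exact: dramp_continuous.
have ic := itv_integrableM a (a + r) ig md (fun x => dramp_bound a x N0).
have id : leb.-integrable `[a, a + r] (EFin \o dramp N a).
  by apply: continuous_itv_integrable => x _; exact: dramp_continuous.
have -> : g a = \int[leb]_(x in `[a, a + r]) (g a * dramp N a x).
  by rewrite RintegralZl// c1 mulr1.
have id' : leb.-integrable `[a, a + r] (EFin \o (fun x => g a * dramp N a x)).
  by apply: continuous_itv_integrable => x _; apply: cvgM; [exact: cvg_cst|exact: dramp_continuous].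
rewrite -RintegralB//.
have /(_ ltac:(by [])) ib := integrableB _ ic id'.
rewrite (le_trans (le_normr_Rintegral _ ib))//.
have idist := itv_integrable_dist (g a) a (a + r) ig.
have /(_ ltac:(by [])) iK := integrableZl _ (N * K) idist.
apply: (@le_trans _ _ (\int[leb]_(x in `[a, a + r]) (N * K * `|g x - g a|))).
  apply: le_Rintegral => //; first exact: (integrable_norm ib).
  move=> x _; rewrite -mulrBl normrM mulrC ler_wpM2r//.
  by rewrite dramp_bound.
rewrite RintegralZl//.
have K0 : 0 <= K by exact: le_trans (dthetaK 0).
have hr : \int[leb]_(x in `[a, a + r]) `|g x - g a| <= e * r by apply: H; rewrite rp.
apply: le_trans (ler_wpM2l _ hr) _; first by rewrite mulr_ge0// ltW.
have -> : N * K * (e * r) = N * r * (K * e) by ring.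
by rewrite Nr mul1r.
Qed.

Let cutoff N a b x := ramp N a x - ramp N b x.

Lemma test_fun_cutoff N a b : 0 < N -> a < b -> test_fun (cutoff N a b).
Proof.
move=> N0 ab; split.
  apply: diff_classP => n; rewrite (_ : cutoff N a b = fun x =>
    ramp N a x + (- 1) * ramp N b x); last first.
    by apply/funext => x; rewrite mulN1r.
  apply: diff_classD => //; apply: diff_classM => //; exact: diff_class_cst.
have NV : 0 < N^-1 by rewrite invr_gt0.
exists (`|a| + `|b| + N^-1) => x.
have := ler_norm a; have := ler_norm (- a); have := ler_norm b; rewrite normrN => h1 h2 h3.
rewrite lter_normr => /orP[hx|hx]; rewrite /cutoff /ramp.
  have le1 y : y <= `|a| + `|b| -> 1 <= N * x + - (N * y).
    move=> yab; rewrite -mulrBr -(ler_pM2l NV) mulr1 mulrA mulVf ?gt_eqF// mul1r; lra.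
  by rewrite !theta_ge1 ?subrr//; apply: le1; have := normr_ge0 a; lra.
have le0 y : - (`|a| + `|b|) <= y -> N * x + - (N * y) <= 0.
  by move=> yab; rewrite -mulrBr pmulr_rle0//; lra.
by rewrite !theta_le0 ?subrr//; apply: le0; have := normr_ge0 b; have := ler_norm (- b); rewrite normrN; lra.
Qed.

Lemma derive1_cutoff N a b x : derive1 (cutoff N a b) x = dramp N a x - dramp N b x.
Proof.
have h : is_derive x 1 (cutoff N a b) (dramp N a x + - dramp N b x).
  by apply: is_derive1D => //; exact: is_derive1N.
by rewrite derive1E derive_val.
Qed.

(** The cutoff differs from the indicator of [[a, b]] only on [[a, a + r]] and [[b, b + r]]. The
    Lebesgue points [a] and [b] make the integral of [|h|] over these intervals of order [r]. *)
Lemma cutoff_approx h a b : measurable_fun [set: R] h -> itv_integrable h ->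
  a < b -> lebesgue_pt h a -> lebesgue_pt h b -> forall e, 0 < e ->
  exists2 r0, 0 < r0 & forall N, 0 < N -> N^-1 < r0 ->
    `|\int[leb]_x (h x * cutoff N a b x) - \int[leb]_(x in `[a, b]) h x| <= e.
Proof.
move=> mh ih ab ha hb e e0.
have [ra ra0 Ha] := lebesgue_pt_right mh ih ha ltr01.
have [rb rb0 Hb] := lebesgue_pt_right mh ih hb ltr01.
(* The sum of [2 * (1 + |h c|)] over [c = a, b], the constants in [key] below. *)
pose C := 2 * (2 + `|h a| + `|h b|).
have C0 : 0 < C by rewrite /C; have := normr_ge0 (h a); have := normr_ge0 (h b); lra.
exists (Num.min (Num.min ra rb) (Num.min (Num.min 1 (b - a)) (e / C))).
  by rewrite !lt_min ra0 rb0 ltr01 subr_gt0 ab divr_gt0.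
move=> N N0; set r := N^-1; rewrite !lt_min => /andP[/andP[rra rrb] /andP[/andP[r1 rba] rC]].
have r0 : 0 < r by rewrite invr_gt0.
have rp y x : (N * x + - (N * y)) * r = x - y by rewrite /r; field; rewrite gt_eqF.
have ramp0 y x : x <= y -> ramp N y x = 0.
  by move=> xy; apply: theta_le0; rewrite -(ler_pM2r r0) rp; lra.
have ramp1 y x : y + r <= x -> ramp N y x = 1.
  by move=> xy; apply: theta_ge1; rewrite -(ler_pM2r r0) rp; lra.
rewrite (@Rintegral_support setT `[a, b + 1]%classic)//; last first.
  move=> x _ /= /negP; rewrite in_itv/= negb_and -!ltNge => /orP[xa|xb].
    by rewrite /cutoff !ramp0 ?subrr ?mulr0//; lra.
  by rewrite /cutoff !ramp1 ?subrr ?mulr0//; lra.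
pose chi (x : R) : R := \1_(`[a, b]%classic) x.
have chiE x : chi x = if a <= x <= b then 1 else 0.
  by rewrite /chi indicE mem_setE in_itv/=; case: ifP.
have -> : \int[leb]_(x in `[a, b]) h x = \int[leb]_(x in `[a, b + 1]) (h x * chi x).
  rewrite (@Rintegral_support `[a, b + 1]%classic `[a, b]%classic); last 2 first.
  - by move=> x /=; rewrite !in_itv/= => /andP[-> ?]/=; lra.
  - by move=> x _ /= /negP; rewrite in_itv/= chiE => /negbTE ->; rewrite mulr0.
  by apply: eq_Rintegral => x /set_mem/=; rewrite in_itv/= chiE => ->; rewrite mulr1.
have mchi : measurable_fun [set: R] chi by exact: measurable_indic.
have mcut : measurable_fun [set: R] (cutoff N a b).
  by apply: measurable_funB; apply: continuous_measurable_fun; exact: ramp_continuous.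
have bchi x : `|chi x| <= 1 by rewrite chiE; case: ifP => _; rewrite ?normr1 ?normr0.
have bcut x : `|cutoff N a b x| <= 1.
  rewrite /cutoff ler_norml; have := theta01 (N * x + - (N * a)).
  by have := theta01 (N * x + - (N * b)); rewrite /ramp; lra.
have ibd := itv_integrableM a (b + 1) ih (measurable_funB mcut mchi) (K := 2).
have b2 x : `|cutoff N a b x - chi x| <= 2.
  by rewrite (le_trans (ler_normB _ _))//; have := bchi x; have := bcut x; lra.
have {}ibd := ibd b2.
rewrite -RintegralB//; last 2 first.
- exact: itv_integrableM mcut bcut.
- exact: itv_integrableM mchi bchi.
under eq_Rintegral do rewrite -mulrBr.
rewrite (le_trans (le_normr_Rintegral _ ibd))//.
pose F x := `|h x * (cutoff N a b x - chi x)|.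
have iF : leb.-integrable `[a, b + 1] (EFin \o F) := integrable_norm ibd.
have subAB : `[a, a + r] `|` `[b, b + r] `<=` `[a, b + 1].
  by move=> x [] /=; rewrite !in_itv/= => /andP[? ?]; apply/andP; split; lra.
rewrite (@Rintegral_support _ (`[a, a + r] `|` `[b, b + r])%classic)//; last first.
  move=> x /=; rewrite !in_itv/= => /andP[ax xb] /not_orP[/negP nA /negP nB].
  rewrite (_ : cutoff N a b x - chi x = 0) ?mulr0 ?normr0//.
  move: nA nB; rewrite ax !negb_and/= -!ltNge => axr.
  rewrite chiE ax/= /cutoff => /orP[xb'|xb'].
    by rewrite (ltW xb') (ramp1 a) ?(ramp0 b) ?subr0 ?subrr ?ltW.
  by rewrite leNgt (_ : b < x) ?ramp1 ?subrr//; lra.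
rewrite Rintegral_setU//; last 2 first.
- by apply: integrableS iF => //; exact: measurableU.
- by apply/disj_setPS => x [] /=; rewrite !in_itv/= => /andP[? ?] /andP[? ?]; lra.
have key c : `[c, c + r] `<=` `[a, b + 1] ->
    \int[leb]_(x in `[c, c + r]) `|h x - h c| <= 1 * r ->
    \int[leb]_(x in `[c, c + r]) F x <= 2 * (1 + `|h c|) * r.
  move=> sub hc.
  have icst : leb.-integrable `[c, c + r] (EFin \o cst `|h c|).
    by apply: continuous_itv_integrable => ? _; exact: cvg_cst.
  have idist := itv_integrable_dist (h c) c (c + r) ih.
  have /(_ ltac:(by [])) isum := integrableD _ idist icst.
  have /(_ ltac:(by [])) isum2 := integrableZl _ 2 isum.
  apply: (@le_trans _ _ (\int[leb]_(x in `[c, c + r]) (2 * (`|h x - h c| + `|h c|)))).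
    apply: le_Rintegral => //; first exact: integrableS iF.
    move=> x _; rewrite /F normrM mulrC; apply: ler_pM => //.
    by rewrite -{1}(subrK (h c) (h x)) ler_normD.
  rewrite RintegralZl// RintegralD// Rintegral_cst//= lebesgue_measure_itv/= lte_fin ltrDl r0.
  by rewrite -EFinB/=; nra.
have rC' : r * C < e by rewrite -ltr_pdivlMr.
have := key a (subset_trans (@subsetUl _ _ _) subAB).
have := key b (subset_trans (@subsetUr _ _ _) subAB).
have := Ha r ltac:(by rewrite r0).
have := Hb r ltac:(by rewrite r0).
move=> h1 h2 /(_ h1) h3 /(_ h2) h4.
by apply: le_trans (lerD h4 h3) _; rewrite /C in rC'; lra.
Qed.

(** [u], [w], [I4] stand for [g a], [g b] and the integral of [h] over [[a, b]]; [I1], [I2], [I3]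
    are their smoothed counterparts. *)
Let limit_identity (I1 I2 I3 I4 u w C d : R) :
  `|I1 - u| <= C * d -> `|I2 - w| <= C * d -> `|I3 - I4| <= d -> I1 - I2 = - I3 ->
  `|w - u - I4| <= d * (2 * C + 1).
Proof.
by rewrite !ler_distl => /andP[? ?] /andP[? ?] /andP[? ?] ?; apply/andP; split; lra.
Qed.

(* du Bois-Reymond: test the weak derivative against smoothed indicators of [a, b] *)
Lemma weak_deriv_lebesgue_pt g h a b :
  measurable_fun [set: R] g -> measurable_fun [set: R] h ->
  itv_integrable g -> itv_integrable h -> weak_deriv g h -> a < b ->
  lebesgue_pt g a -> lebesgue_pt g b -> lebesgue_pt h a -> lebesgue_pt h b ->
  g b - g a = \int[leb]_(x in `[a, b]) h x.
Proof.
move=> mg mh ig ih gh ab ga gb ha hb.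
have K0 : 0 <= K by exact: le_trans (dthetaK 0).
apply/eqP; rewrite -subr_eq0 -normr_le0; apply/ler_addgt0Pl => e e0; rewrite addr0.
(* Two errors [K * e'] come from the ends and one error [e'] from the cutoff. *)
pose e' := e / (2 * K + 1).
have e'0 : 0 < e' by rewrite divr_gt0//; lra.
have e'E : e' * (2 * K + 1) = e by rewrite divfK// gt_eqF//; lra.
have [r1 r10 H1] := approx_delta mg ig ga e'0.
have [r2 r20 H2] := approx_delta mg ig gb e'0.
have [r3 r30 H3] := cutoff_approx mh ih ab ha hb e'0.
(* Halving the minimum makes [r] strictly smaller than every threshold; the sharpness used is
   [N = r^-1]. *)
pose r := Num.min 1 (Num.min (Num.min r1 r2) r3) / 2.
have r0 : 0 < r by rewrite divr_gt0// !lt_min ltr01 r10 r20.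
have rlt y : Num.min 1 (Num.min (Num.min r1 r2) r3) <= y -> r < y.
  by move: r0; rewrite /r; lra.
have NV : r^-1 ^-1 = r by rewrite invrK.
have N0 : 0 < r^-1 by rewrite invr_gt0.
have {}H1 := H1 _ N0; rewrite NV in H1; have {}H1 := H1 (rlt _ _).
have {}H2 := H2 _ N0; rewrite NV in H2; have {}H2 := H2 (rlt _ _).
have {}H3 := H3 _ N0; rewrite NV in H3; have {}H3 := H3 (rlt _ _).
have {}H1 := H1 ltac:(by rewrite !ge_min lexx !orbT).
have {}H2 := H2 ltac:(by rewrite !ge_min lexx !orbT).
have {}H3 := H3 ltac:(by rewrite !ge_min lexx !orbT).
have r1' : r < 1 by apply: rlt; rewrite ge_min lexx.
have md c : measurable_fun [set: R] (dramp r^-1 c).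
  by apply: continuous_measurable_fun; exact: dramp_continuous.
have dr0 c x : x < c \/ c + r < x -> dramp r^-1 c x = 0.
  move=> cx; rewrite /dramp dtheta0 ?mulr0//.
  have rx : (r^-1 * x + - (r^-1 * c)) * r = x - c by field; rewrite gt_eqF.
  case: cx => cx; [left|right]; rewrite -(ltr_pM2r r0) rx; lra.
have idr c := itv_integrableM a (b + 1) ig (md c) (fun x => dramp_bound c x N0).
have := congr1 fine (gh _ (test_fun_cutoff N0 ab)).
rewrite fineN -/(Rintegral leb setT (fun x => g x * derive1 (cutoff r^-1 a b) x)).
rewrite -/(Rintegral leb setT (fun x => h x * cutoff r^-1 a b x)).
rewrite (@Rintegral_support setT `[a, b + 1]%classic)//; last first.
  move=> x _ /= /negP; rewrite in_itv/= negb_and -!ltNge => xab.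
  rewrite derive1_cutoff !dr0 ?subrr ?mulr0//.
    by case/orP: xab => ?; [left|right]; lra.
  by case/orP: xab => ?; [left|right]; lra.
under eq_Rintegral do rewrite derive1_cutoff mulrBr.
rewrite RintegralB//.
rewrite (@Rintegral_support `[a, b + 1]%classic `[a, a + r]%classic); last 2 first.
- move=> x /=; rewrite !in_itv/= => /andP[-> ?]/=; lra.
- move=> x _ /= /negP; rewrite in_itv/= negb_and -!ltNge => xab.
  by rewrite dr0 ?mulr0//; case/orP: xab; [left|right].
rewrite (@Rintegral_support `[a, b + 1]%classic `[b, b + r]%classic); last 2 first.
- move=> x /=; rewrite !in_itv/= => /andP[? ?]; apply/andP; split; lra.
- move=> x _ /= /negP; rewrite in_itv/= negb_and -!ltNge => xab.
  by rewrite dr0 ?mulr0//; case/orP: xab; [left|right].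
by move=> I12; rewrite -e'E; exact: limit_identity H1 H2 H3 I12.
Qed.

End cutoff.
End weak_derivative.

(** * Almost everywhere statements and primitives of weak derivatives *)

Section lebesgue_ae.
Variable R : realType.
Local Notation leb := (@lebesgue_measure R).

Lemma ae_mono (P Q : R -> Prop) : (forall x, P x -> Q x) ->
  {ae leb, forall x, P x} -> {ae leb, forall x, Q x}.
Proof.
move=> PQ [N [mN N0 PN]]; exists N; split => //.
by apply: subset_trans PN => x /= nQ /PQ.
Qed.

Lemma ae_and (P Q : R -> Prop) : {ae leb, forall x, P x} -> {ae leb, forall x, Q x} ->
  {ae leb, forall x, P x /\ Q x}.
Proof.
move=> [N [mN N0 PN]] [M [mM M0 PM]]; exists (N `|` M); split.
- exact: measurableU.
- by rewrite null_set_setU.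
- move=> x /= nPQ; have [px|/PN] := pselect (P x); last by left.
  by have [qx|/PM] := pselect (Q x); [case: nPQ|right].
Qed.

(** An open interval of positive length cannot lie in a null set. *)
Lemma ae_dense (P : R -> Prop) : {ae leb, forall x, P x} ->
  forall a b, a < b -> exists2 x, a < x < b & P x.
Proof.
move=> [N [mN N0 PN]] a b ab; apply: contrapT => H.
have sub : `]a, b[%classic `<=` N.
  move=> x /=; rewrite in_itv/= => xab; apply: PN => /= Px; apply: H.
  by exists x.
have : (leb `]a, b[%classic <= leb N)%E by apply: le_measure => //; rewrite inE.
rewrite N0 lebesgue_measure_itv/= lte_fin ab -EFinB lee_fin; lra.
Qed.

Lemma ae_preimage (f : R -> R) (P : R -> Prop) : measurable_fun [set: R] f ->
  (forall A, measurable A -> leb (f @^-1` A) = leb A) ->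
  {ae leb, forall x, P x} -> {ae leb, forall x, P (f x)}.
Proof.
move=> mf fE [N [mN N0 PN]]; exists (f @^-1` N); split.
- by rewrite -[X in measurable X]setTI; exact: mf.
- by rewrite fE.
- by move=> x /= H; apply: PN.
Qed.

(** The image measure under the translation agrees with Lebesgue measure on half-open intervals,
    which determine it. *)
Lemma lebesgue_measure_shift (p : R) (A : set R) : measurable A ->
  leb ((fun x => x + p) @^-1` A) = leb A.
Proof.
move=> mA.
have mp : measurable_fun [set: R] (fun x : R => x + p) by exact: measurable_funD.
rewrite -[LHS]/(pushforward leb ((fun x => x + p) : _ -> measurableTypeR R) A).
apply/esym/lebesgue_measure_unique => //= _ [[a b]] _ <-.
rewrite /pushforward/= [X in _ = leb X](_ : _ = `]a - p, b - p]%classic); last first.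
  by apply/seteqP; split => x /=; rewrite !in_itv/= ltrBlDr lerBrDr.
rewrite !lebesgue_measure_itv/= !lte_fin ltrD2r; case: ifP => // _.
by rewrite -!EFinB; congr EFin; ring.
Qed.

Lemma ae_shift (p : R) (P : R -> Prop) :
  {ae leb, forall x, P x} -> {ae leb, forall x, P (x + p)}.
Proof.
by apply: ae_preimage; [exact: measurable_funD|exact: lebesgue_measure_shift].
Qed.

(** Serves the substitution [a |-> x - a] inside the kernel. *)
Lemma ae_reflect (p : R) (P : R -> Prop) :
  {ae leb, forall x, P x} -> {ae leb, forall x, P (p - x)}.
Proof.
move=> /(ae_shift p) H.
have /= := @ae_preimage -%R (fun x => P (x + p)) (@oppr_measurable R setT) (@lebesgue_measureN R) H.
by apply: ae_mono => x; rewrite addrC.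
Qed.

Lemma ae_continuous_le (f g : R -> R) : continuous f -> continuous g ->
  {ae leb, forall x, f x <= g x} -> forall x, f x <= g x.
Proof.
move=> cf cg H x; rewrite leNgt; apply/negP => gf.
have c : continuous (fun x => f x - g x) by move=> y; apply: cvgB; [exact: cf|exact: cg].
have [d /= d0 Hd] : \forall y \near x, 0 < f y - g y.
  by apply: (cvgr_gt (f x - g x) (c x)); rewrite subr_gt0.
have xd : x < x + d by rewrite ltrDl.
have [y /andP[xy yd]] := ae_dense H xd.
have : 0 < f y - g y by apply: Hd; rewrite /= distrC gtr0_norm; lra.
lra.
Qed.

Definition is_primitive (v h : R -> R) :=
  forall a b, a <= b -> v b - v a = \int[leb]_(x in `[a, b]) h x.

Lemma itv_integrable_locally (g : R -> R) : measurable_fun [set: R] g ->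
  itv_integrable g -> locally_integrable [set: R] g.
Proof.
move=> mg ig; split => //; first exact: openT.
move=> K _ cK; have [M [_ HM]] := compact_bounded cK.
have sub : K `<=` `[- (`|M| + 1), `|M| + 1]%classic.
  move=> x Kx /=; rewrite in_itv/= -ler_norml; apply: HM => //.
  by have := ler_norm M; lra.
apply: le_lt_trans (integrable_lty _ (integrable_norm (ig (- (`|M| + 1)) (`|M| + 1)))) => //.
apply: ge0_subset_integral => //; first exact: compact_measurable.
by apply: measurableT_comp => //; apply: measurableT_comp => //; exact: measurable_funS mg.
Qed.

(** Almost every point is a Lebesgue point of both [g] and [h]. Integrating [h] from one such point
    [a0] gives [v], and the identity between Lebesgue points gives [g = v] at all the others. *)
Lemma weak_deriv_primitive (g h : R -> R) :
  measurable_fun [set: R] g -> measurable_fun [set: R] h ->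
  itv_integrable g -> itv_integrable h -> weak_deriv g h ->
  exists2 v, {ae leb, forall x, g x = v x} & is_primitive v h.
Proof.
move=> mg mh ig ih gh.
have [theta [ts t0 t1 t01 [dt0 [K dtK]]]] := smooth_step R.
have key := weak_deriv_lebesgue_pt ts t0 t1 t01 dt0 dtK mg mh ig ih gh.
have aeg := lebesgue_differentiation (itv_integrable_locally mg ig).
have aeh := lebesgue_differentiation (itv_integrable_locally mh ih).
have ae2 : {ae leb, forall x, lebesgue_pt g x /\ lebesgue_pt h x}.
  exact: ae_and.
have [a0 _ [ga0 ha0]] := ae_dense ae2 ltr01.
(* Integrals over reversed intervals are [0], not negated, hence the two cases. *)
pose v x := g a0 + (if a0 <= x then \int[leb]_(y in `[a0, x]) h y
                    else - \int[leb]_(y in `[x, a0]) h y).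
exists v.
  apply: ae_mono ae2 => x [gx hx]; rewrite /v; case: ltgtP => [ax|xa|<-].
  - by rewrite -(key _ _ ax)//; lra.
  - by rewrite -(key _ _ xa)//; lra.
  - by rewrite set_itv1 Rintegral_set1 addr0.
move=> a b ab; rewrite /v; have [aa|aa] := leP a0 a.
  by rewrite (le_trans aa ab) (Rintegral_itv_cat ih aa ab); lra.
have [bb|bb] := leP a0 b.
  by rewrite (Rintegral_itv_cat ih (ltW aa) bb); lra.
by rewrite (Rintegral_itv_cat ih ab (ltW bb)); lra.
Qed.

End lebesgue_ae.

(** * Sobolev regularity of H^k profiles *)

Section sobolev.
Variable R : realType.
Local Notation leb := (@lebesgue_measure R).
Implicit Types g h v : R -> R.

Lemma ge0_integral_itv_cat (f : R -> \bar R) (a b c : R) :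
  measurable_fun [set: R] f -> (forall x, (0 <= f x)%E) -> a <= b -> b <= c ->
  (\int[leb]_(x in `[a, c]) f x <=
   \int[leb]_(x in `[a, b]) f x + \int[leb]_(x in `[b, c]) f x)%E.
Proof.
move=> mf f0 ab bc.
rewrite (@itv_bndbnd_setU _ _ (BLeft a) (BRight b) (BRight c))// ?bnd_simp//.
rewrite ge0_integral_setU//.
- apply: leeD => //; apply: ge0_subset_integral => //.
    exact: measurable_funS mf.
  by apply: subset_itvr; rewrite bnd_simp.
- exact: measurable_funS mf.
- apply/disj_setPS => x [] /=; rewrite !in_itv/= => /andP[_ xb] /andP[bx _].
  by move: (lt_le_trans bx xb); rewrite ltxx.
Qed.

Lemma ge0_integral_shift (f : R -> \bar R) (a b p : R) :
  measurable_fun [set: R] f -> (forall x, (0 <= f x)%E) ->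
  (\int[leb]_(x in `[(a + p)%R, (b + p)%R]) f x = \int[leb]_(x in `[a, b]) f (x + p)%R)%E.
Proof.
move=> mf f0.
rewrite (_ : `[a, b]%classic =
    ((fun x : R => x + p) : _ -> measurableTypeR R) @^-1` `[a + p, b + p]); last first.
  by apply/seteqP; split => x /=; rewrite !in_itv/= !lerD2r.
rewrite -ge0_integral_pushforward//=; [|exact: measurable_funD|exact: measurable_funS mf].
apply: eq_measure_integral => [|? A mA _]; first exact: measurable_funD.
exact/esym/lebesgue_measure_shift.
Qed.

Lemma measurable_sqr g : measurable_fun [set: R] g ->
  measurable_fun [set: R] (fun x => ((g x) ^+ 2)%:E).
Proof. by move=> mg; apply/measurable_EFinP; exact: measurable_funX. Qed.

Lemma dom_periodic_int g : dom_periodic Torus g -> forall (n : int) x,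
  g (x + (2 * pi) *~ n) = g x.
Proof.
move=> gp; have gn (n : nat) x : g (x + (2 * pi) *+ n) = g x.
  by elim: n => [|n IH]; [rewrite mulr0n addr0|rewrite mulrSr addrA gp].
case=> n x; first by rewrite -pmulrn.
by rewrite NegzE mulrNz -pmulrn -[in RHS](subrK ((2 * pi) *+ n.+1) x) gn.
Qed.

(** On the torus, [z] is moved by periods into [[0, 2 pi)]; the unit interval then lies in two
    consecutive periods, hence the factor [2]. *)
Lemma integral_unit_le (O : domain) g (z : R) :
  measurable_fun [set: R] g -> dom_periodic O g ->
  (\int[leb]_(x in `[z, (z + 1)%R]) ((g x) ^+ 2)%:E <=
   2%:E * \int[leb]_(x in dom_set O) ((g x) ^+ 2)%:E)%E.
Proof.
move=> mg; have sq0 x : (0 <= ((g x) ^+ 2)%:E)%E by rewrite lee_fin sqr_ge0.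
have msq := measurable_sqr mg.
have dbl (x : \bar R) : (x + x = 2%:E * x)%E by rewrite -[in LHS](mul1e x) -ge0_muleDl// -EFinD.
case: O => [_|gp]/=.
  rewrite -dbl; apply: le_trans (leeDl _ _); last by apply: integral_ge0.
  exact: ge0_subset_integral.
pose p : R := 2 * pi; have p2 : 2 <= p by rewrite /p; have := @pi_ge2 R; lra.
pose n := Num.floor (z / p); pose r := z - p *~ n.
have p0 : 0 < p by lra.
have [r0 rp] : 0 <= r /\ r < p.
  have := @floor_itv R (z / p); rewrite -/n => /andP[h1 h2].
  rewrite /r -mulrzr; split.
    by rewrite subr_ge0 mulrC -ler_pdivlMr.
  by rewrite ltrBlDr -{1}(mulr1 p) -mulrDr mulrC -ltr_pdivrMr// (lt_le_trans h2)// intrD addrC.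
have zE : z = r + p *~ n by rewrite /r subrK.
move: (r) r0 rp zE => {}r r0 rp ->.
rewrite addrAC ge0_integral_shift//.
under eq_integral do rewrite dom_periodic_int//.
rewrite -dbl.
apply: (@le_trans _ _ (\int[leb]_(x in `[0%R, (p + p)%R]) (g x ^+ 2)%:E)%E).
  apply: ge0_subset_integral => //; first exact: measurable_funS msq.
  by move=> x /=; rewrite !in_itv/= => /andP[? ?]; apply/andP; split; lra.
apply: le_trans (ge0_integral_itv_cat msq sq0 (ltW p0) _) _; first lra.
apply: leeD => //; rewrite -{1}(add0r p) ge0_integral_shift//.
by under eq_integral do rewrite gp.
Qed.

(** A bounded interval is covered by finitely many unit intervals. *)
Lemma itv_integrable_unit g : measurable_fun [set: R] g ->
  (forall z, (\int[leb]_(x in `[z, (z + 1)%R]) `|g x|%:E < +oo)%E) -> itv_integrable g.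
Proof.
move=> mg ug.
have mag : measurable_fun [set: R] (fun x => `|g x|%:E).
  by apply/measurable_EFinP; exact: measurableT_comp.
have ag0 x : (0 <= `|g x|%:E)%E by rewrite lee_fin.
have nat_lt a n : (\int[leb]_(x in `[a, (a + n%:R)%R]) `|g x|%:E < +oo)%E.
  elim: n => [|n IH]; first by rewrite addr0 set_itv1 integral_set1.
  rewrite -natr1 addrA.
  apply: le_lt_trans (ge0_integral_itv_cat mag ag0 (_ : a <= a + n%:R) _) _.
  - by rewrite lerDl.
  - by rewrite lerDl.
  - exact: lte_add_pinfty.
move=> a b; apply/integrableP; split.
  by apply/measurable_EFinP; exact: measurable_funS mg.
apply: le_lt_trans (nat_lt a (Num.bound `|b - a|)).
apply: ge0_subset_integral => //; first exact: measurable_funS mag.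
move=> x /=; rewrite !in_itv/= => /andP[-> xb]/=; rewrite (le_trans xb)//.
by have := archi_boundP (normr_ge0 (b - a)); have := ler_norm (b - a); lra.
Qed.

(** Replaces the Cauchy-Schwarz inequality. The parameter [l] is free: for [c] of order [l^2] the
    bound is linear in [l]. *)
Lemma integral_unit_norm_le g (z l c : R) : measurable_fun [set: R] g -> 0 < l ->
  (\int[leb]_(x in `[z, (z + 1)%R]) ((g x) ^+ 2)%:E <= c%:E)%E ->
  (\int[leb]_(x in `[z, (z + 1)%R]) `|g x|%:E <= (l / 2 + c / (2 * l))%:E)%E.
Proof.
move=> mg l0 gc.
have msq := measurable_sqr mg.
have l20 : 0 <= (2 * l)^-1 by rewrite invr_ge0; lra.
apply: (@le_trans _ _ (\int[leb]_(x in `[z, (z + 1)%R])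
    ((l / 2)%:E + (2 * l)^-1%:E * (g x ^+ 2)%:E))%E).
  apply: ge0_le_integral => //.
  - by apply/measurable_EFinP; apply: measurableT_comp => //; exact: measurable_funS mg.
  - apply: emeasurable_funD => //; apply: measurable_funeM; exact: measurable_funS msq.
  - (* AM-GM *)
    move=> x _; rewrite -EFinM -EFinD lee_fin -(real_normK (num_real (g x))).
    rewrite -(ler_pM2r (_ : 0 < 2 * l)); last lra.
    have -> : (l / 2 + (2 * l)^-1 * `|g x| ^+ 2) * (2 * l) = l ^+ 2 + `|g x| ^+ 2.
      by field; rewrite gt_eqF.
    by have := sqr_ge0 (l - `|g x|); nra.
rewrite ge0_integralD//; last 3 first.
- by move=> x _; rewrite lee_fin divr_ge0// ltW.
- by move=> x _; rewrite -EFinM lee_fin mulr_ge0// sqr_ge0.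
- by apply: measurable_funeM; exact: measurable_funS msq.
rewrite integral_cst//= lebesgue_measure_itv/= lte_fin ltrDl ltr01 -EFinB addrAC subrr add0r mule1.
rewrite ge0_integralZl//; last 2 first.
- exact: measurable_funS msq.
- by move=> x _; rewrite lee_fin sqr_ge0.
by rewrite EFinD leeD2l// (mulrC c) EFinM lee_wpmul2l.
Qed.

(** [v] is the absolutely continuous representative of [g], and [h] is the derivative. The [L^2]
    bounds over [dom_set O] concern [g] and [h], whence the periodicity fields for these two. *)
Record H1rep (O : domain) g h v : Prop := {
  H1rep_measurable : measurable_fun [set: R] g;
  H1rep_measurable_deriv : measurable_fun [set: R] h;
  H1rep_periodic : dom_periodic O g;
  H1rep_periodic_deriv : dom_periodic O h;
  H1rep_integrable : itv_integrable g;
  H1rep_integrable_deriv : itv_integrable h;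
  H1rep_ae : {ae leb, forall x, g x = v x};
  H1rep_primitive : is_primitive v h }.

(** Compare [v x] with [v y] for [y] in [[x, x + 1]] and integrate in [y]: [|v x|] is at most the
    integral of [|g|] plus that of [|h|] over the unit interval, each at most [3 * l / 2]. *)
Lemma H1rep_sup O g h v (l : R) : H1rep O g h v -> 0 < l ->
  (\int[leb]_(x in dom_set O) ((g x) ^+ 2)%:E <= (l ^+ 2)%:E)%E ->
  (\int[leb]_(x in dom_set O) ((h x) ^+ 2)%:E <= (l ^+ 2)%:E)%E ->
  forall x, `|v x| <= 3 * l.
Proof.
move=> [mg mh gO hO ig ih gv vh] l0 gl hl x.
have unit f : measurable_fun [set: R] f -> dom_periodic O f ->
    (\int[leb]_(x in dom_set O) ((f x) ^+ 2)%:E <= (l ^+ 2)%:E)%E ->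
    (\int[leb]_(y in `[x, (x + 1)%R]) `|f y|%:E <= (3 * l / 2)%:E)%E.
  move=> mf fO fl.
  have := @integral_unit_norm_le f x l (2 * l ^+ 2) mf l0.
  rewrite (_ : l / 2 + 2 * l ^+ 2 / (2 * l) = 3 * l / 2); last by field; rewrite gt_eqF.
  apply; apply: le_trans (integral_unit_le x mf fO) _.
  by rewrite [leRHS]EFinM lee_wpmul2l.
have vosc y : x <= y <= x + 1 -> `|v x| <= `|v y| + 3 * l / 2.
  move=> /andP[xy yx1].
  have : `|v y - v x| <= 3 * l / 2.
    rewrite (vh _ _ xy) (le_trans (le_normr_Rintegral _ (ih x y)))//.
    rewrite -lee_fin /Rintegral fineK; last first.
      by apply: integrable_fin_num => //; exact: (integrable_norm (ih x y)).
    apply: le_trans (unit h mh hO hl); apply: ge0_subset_integral => //.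
      by apply/measurable_EFinP; apply: measurableT_comp => //; exact: measurable_funS mh.
    by apply: subset_itvl; rewrite bnd_simp.
  by have := ler_normB (v y) (v y - v x); rewrite subKr; lra.
have mG : measurable_fun `[x, x + 1] (fun y => `|g y|%:E).
  by apply/measurable_EFinP; apply: measurableT_comp => //; exact: measurable_funS mg.
have : (\int[leb]_(y in `[x, (x + 1)%R]) (cst (`|v x|%:E) y) <=
        \int[leb]_(y in `[x, (x + 1)%R]) (`|g y|%:E + (3 * l / 2)%:E))%E.
  apply: ae_ge0_le_integral => //.
  - by move=> y _; rewrite lee_fin.
  - by move=> y _; rewrite -EFinD lee_fin addr_ge0//; lra.
  - by apply: emeasurable_funD.
  - apply: (@ae_mono _ (fun y => g y = v y)) gv => y /= -> /=.
    by rewrite in_itv/= -EFinD lee_fin; exact: vosc.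
rewrite integral_cst//= lebesgue_measure_itv/= lte_fin ltrDl ltr01 -EFinB.
rewrite (addrAC x) subrr add0r mule1 ge0_integralD//; last first.
  by move=> y _; rewrite lee_fin; lra.
rewrite integral_cst//= lebesgue_measure_itv/= lte_fin ltrDl ltr01 -EFinB.
rewrite (addrAC x) subrr add0r mule1 => H; rewrite -lee_fin (le_trans H)//.
rewrite [leRHS](_ : _ = (3 * l / 2)%:E + (3 * l / 2)%:E)%E; last first.
  by rewrite -EFinD; congr EFin; lra.
by rewrite leeD2r//; exact: unit.
Qed.

End sobolev.

(** * Bounded representatives with Lipschitz derivative *)

Section Hk_regularity.
Variable R : realType.
Local Notation leb := (@lebesgue_measure R).
Implicit Types g h v : R -> R.

Lemma Hk_term_le O k (gs : nat -> R -> R) j : (j <= k)%N ->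
  (\int[leb]_(x in dom_set O) ((gs j x) ^+ 2)%:E <= Hk_normsq O k gs)%E.
Proof.
move=> jk; have jk1 : (j < k.+1)%N by [].
rewrite /Hk_normsq (bigD1 (Ordinal jk1))//=; apply: leeDl.
by apply: sume_ge0 => i _; apply: integral_ge0 => x _; rewrite lee_fin sqr_ge0.
Qed.

Lemma in_Hk_rep O k g (gs : nat -> R -> R) j : in_Hk O k g gs -> (j < k)%N ->
  exists v, H1rep O (gs j) (gs j.+1) v.
Proof.
move=> [_ mO wd fin] jk.
have ii i : (i <= k)%N -> itv_integrable (gs i).
  move=> ik; have [mi iO] := mO i ik; apply: itv_integrable_unit => // z.
  have ci := le_lt_trans (Hk_term_le O gs ik) fin.
  have I0 : (0 <= \int[leb]_(x in dom_set O) ((gs i x) ^+ 2)%:E)%E.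
    by apply: integral_ge0 => x _; rewrite lee_fin sqr_ge0.
  set I := (\int[leb]_(x in dom_set O) ((gs i x) ^+ 2)%:E)%E in ci I0.
  have If : I = (fine I)%:E by rewrite fineK// ge0_fin_numE.
  have := @integral_unit_norm_le R (gs i) z 1 (2 * fine I) mi ltr01.
  rewrite EFinM -If => /(_ (integral_unit_le z mi iO)) H.
  by rewrite (le_lt_trans H)// ltry.
have [mj jO] := mO j (ltnW jk); have [mj1 j1O] := mO j.+1 jk.
have [v gv vh] := weak_deriv_primitive mj mj1 (ii j (ltnW jk)) (ii j.+1 jk) (wd j jk).
by exists v; split => //; apply: ii => //; exact: ltnW.
Qed.

Lemma itv_integrable_lin g1 g2 (c1 c2 : R) : itv_integrable g1 -> itv_integrable g2 ->
  itv_integrable (fun x => c1 * g1 x + c2 * g2 x).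
Proof.
move=> i1 i2 a b; have /(_ ltac:(by [])) j1 := integrableZl _ c1 (i1 a b).
have /(_ ltac:(by [])) j2 := integrableZl _ c2 (i2 a b).
by have /(_ ltac:(by [])) := integrableD _ j1 j2.
Qed.

(** Provides representatives for differences and difference quotients in time, whose [H^k] norms are
    what the hypotheses control. *)
Lemma H1rep_lin O g1 h1 v1 g2 h2 v2 (c1 c2 : R) :
  H1rep O g1 h1 v1 -> H1rep O g2 h2 v2 ->
  H1rep O (fun x => c1 * g1 x + c2 * g2 x) (fun x => c1 * h1 x + c2 * h2 x)
    (fun x => c1 * v1 x + c2 * v2 x).
Proof.
move=> [mg1 mh1 gO1 hO1 ig1 ih1 gv1 vh1] [mg2 mh2 gO2 hO2 ig2 ih2 gv2 vh2].
have mlin f1 f2 : measurable_fun [set: R] f1 -> measurable_fun [set: R] f2 ->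
    measurable_fun [set: R] (fun x => c1 * f1 x + c2 * f2 x).
  by move=> m1 m2; apply: measurable_funD; apply: measurable_funM.
split.
- exact: mlin.
- exact: mlin.
- by case: O gO1 gO2 {hO1 hO2} => //= p1 p2 x; rewrite p1 p2.
- by case: O hO1 hO2 {gO1 gO2} => //= p1 p2 x; rewrite p1 p2.
- exact: itv_integrable_lin.
- exact: itv_integrable_lin.
- by apply: ae_mono (ae_and gv1 gv2) => x [-> ->].
- move=> a b ab; have /(_ ltac:(by [])) j1 := integrableZl _ c1 (ih1 a b).
  have /(_ ltac:(by [])) j2 := integrableZl _ c2 (ih2 a b).
  rewrite RintegralD// !RintegralZl//; try exact: ih1.
  by rewrite -(vh1 _ _ ab) -(vh2 _ _ ab); ring.
Qed.

Lemma primitive_lipschitz v h (L : R) : is_primitive v h -> measurable_fun [set: R] h ->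
  itv_integrable h -> {ae leb, forall x, `|h x| <= L} ->
  forall x y, `|v x - v y| <= L * `|x - y|.
Proof.
move=> vh mh ih hL.
have key x y : x <= y -> `|v y - v x| <= L * (y - x).
  move=> xy; rewrite (vh _ _ xy) (le_trans (le_normr_Rintegral _ (ih x y)))//.
  have -> : L * (y - x) = \int[leb]_(z in `[x, y]) L.
    rewrite Rintegral_cst//= lebesgue_measure_itv/= lte_fin.
    by case: ltgtP xy => // -> _; rewrite /= subrr.
  have L0 : 0 <= L.
    have [z _ hz] := ae_dense hL ltr01; exact: le_trans hz.
  have icst : leb.-integrable `[x, y] (EFin \o cst L).
    by apply: continuous_itv_integrable => ? _; exact: cvg_cst.
  apply: fine_le.
  - by apply: integrable_fin_num => //; exact: (integrable_norm (ih x y)).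
  - exact: integrable_fin_num.
  apply: ae_ge0_le_integral => //.
  - by apply/measurable_EFinP; apply: measurableT_comp => //; exact: measurable_funS mh.
  - by apply: (@ae_mono _ (fun z => `|h z| <= L)) hL => z hz _; rewrite lee_fin.
move=> x y; have [xy|yx] := leP x y; last by rewrite [`|x - y|]gtr0_norm ?subr_gt0// key// ltW.
by rewrite distrC [`|x - y|]distrC [`|y - x|]ger0_norm ?subr_ge0// key.
Qed.

(** Inside the integral [h] may be replaced by its continuous version [w], and then the fundamental
    theorem of calculus applies at every point. *)
Lemma primitive_derive v h w : is_primitive v h -> measurable_fun [set: R] h ->
  {ae leb, forall x, h x = w x} -> continuous w ->
  forall x : R, is_derive x 1 v (w x).
Proof.
move=> vh mh hw cw x.
have iw a b : leb.-integrable `[a, b] (EFin \o w).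
  by apply: continuous_itv_integrable => y _; exact: cw.
have x1 : x - 1 < x by lra.
have x2 : x < x + 1 by lra.
have [dF F'] := continuous_FTC1_closed x2 (iw (x - 1) (x + 1)) x1 (cw x).
pose F y := \int[leb]_(t in `[x - 1, y]) w t.
have hF : is_derive x 1 F (w x).
  by rewrite -F' derive1E; exact/derivableP.
have := is_derive1D (is_derive_cst (v (x - 1)) x 1) hF; rewrite add0r.
apply: near_eq_is_derive; near=> y.
have xy : x - 1 <= y by rewrite ltW//; near: y; exact: lt_nbhsr.
have -> : F y = \int[leb]_(t in `[x - 1, y]) h t.
  congr fine; apply: ae_eq_integral => //.
  - by apply/measurable_EFinP; apply: measurable_funTS; exact: continuous_measurable_fun.
  - by apply/measurable_EFinP; exact: measurable_funS mh.
  - by apply: (@ae_mono _ (fun z => h z = w z)) hw => z /= -> _.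
by rewrite -(vh _ _ xy) /= addrC subrK.
Unshelve. all: by end_near. Qed.

(** Here [3 <= k] matters: bounding [gs 2], which is the Lipschitz constant of the slope, takes an
    [L^2] bound on [gs 3]. *)
Lemma in_Hk_C11 O k g (gs : nat -> R -> R) : (3 <= k)%N -> in_Hk O k g gs ->
  exists v v1 B L, [/\ {ae leb, forall x, g x = v x /\ gs 1%N x = v1 x},
    forall x : R, is_derive x 1 v (v1 x),
    forall x y, `|v1 x - v1 y| <= L * `|x - y| & forall x, `|v x| <= B].
Proof.
move=> k3 Hg.
have bnd j v : (j < k)%N -> H1rep O (gs j) (gs j.+1) v -> exists B, forall x, `|v x| <= B.
  move=> jk rep; have [_ _ _ fin] := Hg.
  have N0 : (0 <= Hk_normsq O k gs)%E.
    by apply: le_trans (Hk_term_le O gs (leq0n k)); apply: integral_ge0 => x _; rewrite lee_fin sqr_ge0.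
  have Nf : Hk_normsq O k gs = (fine (Hk_normsq O k gs))%:E by rewrite fineK// ge0_fin_numE.
  set l := fine (Hk_normsq O k gs) in Nf.
  have l0 : 0 <= l by rewrite -lee_fin -Nf.
  (* Here [l] is the squared norm; [l <= (l + 1)^2] avoids a square root and makes the parameter
     positive. *)
  exists (3 * (l + 1)); apply: (H1rep_sup rep); first lra.
    apply: le_trans (Hk_term_le O gs (ltnW jk)) _; rewrite Nf lee_fin; nra.
  by apply: le_trans (Hk_term_le O gs jk) _; rewrite Nf lee_fin; nra.
have j0 : (0 < k)%N by exact: leq_trans k3.
have j1 : (1 < k)%N by exact: leq_trans k3.
have [v0 r0] := in_Hk_rep Hg j0.
have [v1 r1] := in_Hk_rep Hg j1.
have [v2 r2] := in_Hk_rep Hg k3.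
have [B v0B] := bnd _ _ j0 r0; have [L v2L] := bnd _ _ k3 r2.
have gs2L : {ae leb, forall x, `|gs 2%N x| <= L}.
  by apply: (ae_mono _ (H1rep_ae r2)) => x ->.
have lip := primitive_lipschitz (H1rep_primitive r1) (H1rep_measurable r2)
  (H1rep_integrable r2) gs2L.
exists v0, v1, B, L; split => //.
  by have [<- _ _ _] := Hg; apply: ae_and (H1rep_ae r0) (H1rep_ae r1).
apply: primitive_derive (H1rep_primitive r0) (H1rep_measurable r1) (H1rep_ae r1) _.
exact: lipschitz_continuous1 lip.
Qed.

End Hk_regularity.

(** * The maximum principle *)

Section one_sided_maximum_principle.
Variable R : realType.
Local Notation leb := (@lebesgue_measure R).

(** Maximize [S s - e * s] over [[0, t]]. At a maximizer [c > 0] one would have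
    [S c - S (c - h) >= e * h], against the Dini bound with [e / 2]; so [c = 0] and
    [S t <= S 0 + e * t]. *)
Lemma left_dini_nonincreasing (S : R -> R) (T : R) :
  (forall t, 0 <= t <= T -> forall e, 0 < e -> exists2 d, 0 < d &
     forall s, 0 <= s <= T -> `|s - t| < d -> `|S s - S t| <= e) ->
  (forall t, 0 < t <= T -> forall e, 0 < e -> exists2 d, 0 < d &
     forall h, 0 < h < d -> h <= t -> S t - S (t - h) <= e * h) ->
  forall t, 0 <= t <= T -> S t <= S 0.
Proof.
move=> cS dS t /andP[t0 tT]; apply/ler_addgt0Pr => e0 e00.
pose e := e0 / (t + 1).
have t10 : 0 < t + 1 by lra.
have ep : 0 < e by rewrite divr_gt0.
have eE : e * (t + 1) = e0 by rewrite divfK// gt_eqF.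
have cphi : {within `[0, t], continuous (fun s => S s - e * s)}.
  apply/subspace_continuousP => x; rewrite /= in_itv/= => /andP[x0 xt].
  have xT : 0 <= x <= T by lra.
  apply: cvgB; last first.
    apply: cvg_within_filter; apply: cvgM; [exact: cvg_cst|exact: cvg_id].
  apply/cvgrPdist_le => a a0; have [d d0 H] := cS x xT a a0.
  exists d => //= y xy; rewrite in_itv/= => yt; rewrite distrC; apply: H; first lra.
  by rewrite distrC.
have [c] := EVT_max t0 cphi; rewrite in_itv/= => /andP[c0 ct] cmax.
have [c_0|cn0] := eqVneq c 0.
  have := cmax t; rewrite in_itv/= t0 lexx => /(_ isT); rewrite c_0.
  have : e * t <= e0 by rewrite -eE; nra.
  lra.
have cp : 0 < c by rewrite lt_neqAle eq_sym cn0.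
have e2 : 0 < e / 2 by rewrite divr_gt0.
have cT : 0 < c <= T by lra.
have [d d0 H] := dS c cT (e / 2) e2.
pose h := Num.min (d / 2) c.
have h0 : 0 < h by rewrite lt_min cp divr_gt0.
have hd : h < d by rewrite gt_min; apply/orP; left; lra.
have hc : h <= c by rewrite ge_min lexx orbT.
have := H h; rewrite h0 hd => /(_ isT hc).
have := cmax (c - h); rewrite in_itv/= subr_ge0 hc (_ : c - h <= t); last lra.
move=> /(_ isT); have : 0 < e * h by rewrite mulr_gt0.
rewrite mulrBr => h1 h2 h3; lra.
Qed.

(** All that the maximum principle takes from an [H^k] profile at one time. *)
Definition regular_profile (c : R) (w g : R -> R) :=
  exists v v1 B L, [/\ {ae leb, forall x, w x = v x},
    forall x : R, is_derive x 1 v (v1 x),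
    forall x y, `|v1 x - v1 y| <= L * `|x - y|, forall x, `|v x| <= B &
    {ae leb, forall x, muskat_pv_to c v v1 x (g x)}].

(** The kernel is odd in the pair [(v, v1)], so [- f] obeys the same equation; the lower bound thus
    follows from the upper one. *)
Lemma regular_profileN c w g : regular_profile c w g ->
  regular_profile c (fun x => - w x) (fun x => - g x).
Proof.
move=> [v [v1 [B [L [wv dv v1L vB pv]]]]].
exists (fun x => - v x), (fun x => - v1 x), B, L; split.
- by apply: ae_mono wv => x ->.
- by move=> x; exact: is_derive1N.
- by move=> x y; rewrite -opprD normrN.
- by move=> x; rewrite normrN.
apply: ae_mono pv => x; rewrite /muskat_pv_to => H.
have -> : (fun M => c * Rintegral leb `[- M, M]%classic
    (fun a => (- v1 x - - v1 (x - a)) * a / (a ^+ 2 + (- v x - - v (x - a)) ^+ 2))) =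
  (fun M => - (c * Rintegral leb `[- M, M]%classic (muskat_kernel v v1 x))).
  apply/funext => M; rewrite -mulrN; congr (c * _).
  rewrite -mulN1r -RintegralZl//; last exact: (muskat_kernel_integrable dv v1L).
  apply: eq_Rintegral => a _; rewrite /muskat_kernel -!opprD sqrrN.
  by rewrite !mulNr mul1r.
exact: cvgN.
Qed.

(** If [g x > eta], some truncated integral times [c] exceeds [eta]; near the supremum it is at most
    [c * eta / (c + 1) < eta]. *)
Lemma velocity_near_max c w g S (eta : R) : 0 <= c -> regular_profile c w g -> 0 < eta ->
  {ae leb, forall x, w x <= S} ->
  exists2 d, 0 < d & {ae leb, forall x, S - d < w x -> g x <= eta}.
Proof.
move=> c0 [v [v1 [B [L [wv dv v1L vB pv]]]]] eta0 wS.
have cv : continuous v by move=> y; exact: is_derive_continuous (dv y).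
have vS y : v y <= S.
  apply: (@ae_continuous_le R v (fun=> S)) => //; first by move=> z; exact: cvg_cst.
  by apply: ae_mono (ae_and wv wS) => x [<-].
have e0 : 0 < eta / (c + 1) by rewrite divr_gt0//; lra.
have eE : eta / (c + 1) * (c + 1) = eta by rewrite divfK// gt_eqF//; lra.
have B0 : 0 <= 2 * B by have := le_trans (normr_ge0 _) (vB 0); lra.
have osc y z : `|v y - v z| <= 2 * B.
  by rewrite (le_trans (ler_normB _ _))//; have := vB y; have := vB z; lra.
have [e [d [e_0 d0 H]]] := muskat_kernel_near_max_le dv v1L B0 e0 osc.
exists d => //; apply: ae_mono (ae_and wv pv) => x [wx pvx] Sx.
rewrite leNgt; apply/negP => gx.
have vd y : v y <= v x + d by have := vS y; rewrite -wx; lra.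
have big : \forall M \near +oo, eta < c * Rintegral leb `[- M, M]%classic (muskat_kernel v v1 x).
  exact: (cvgr_gt (g x) pvx).
have [M [eM]] : exists M, e < M /\ eta < c * Rintegral leb `[- M, M]%classic (muskat_kernel v v1 x).
  apply: (@filter_ex _ (+oo)); near=> M; split; near: M => //.
  by apply: nbhs_pinfty_gt; exact: num_real.
have := ler_wpM2l c0 (H x M vd eM); have := e0; nra.
Unshelve. all: by end_near. Qed.

Lemma one_sided_maximum_principle (c T : R) (u g : R -> R -> R) : 0 <= c ->
  (forall t, 0 <= t <= T -> regular_profile c (u t) (g t)) ->
  (forall t, 0 <= t <= T -> forall e, 0 < e -> exists2 d, 0 < d &
     forall s, 0 <= s <= T -> `|s - t| < d ->
       {ae leb, forall x, `|u s x - u t x| <= e}) ->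
  (forall t, 0 <= t <= T -> forall e, 0 < e -> exists2 d, 0 < d &
     forall h, h != 0 -> `|h| < d -> 0 <= t + h <= T ->
       {ae leb, forall x, `|(u (t + h) x - u t x) / h - g t x| <= e}) ->
  forall m, {ae leb, forall x, u 0 x <= m} ->
  forall t, 0 <= t <= T -> {ae leb, forall x, u t x <= m}.
Proof.
move=> c0 reg cont diff m um t tT.
pose E t y := {ae leb, forall x, u t x <= y}.
(* The essential supremum as a real number; boundedness of the profile makes the infimum
   meaningful. *)
pose S t := inf [set y | E t y].
have T0 : 0 <= T by lra.
have ubnd s : 0 <= s <= T -> exists B, {ae leb, forall x, `|u s x| <= B}.
  move=> sT; have [v [v1 [B [L [uv _ _ vB _]]]]] := reg s sT.
  by exists B; apply: ae_mono uv => x ->.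
have Einf s : 0 <= s <= T -> has_inf [set y | E s y].
  move=> sT; have [B uB] := ubnd s sT; split.
    by exists B; apply: ae_mono uB => x; exact: le_trans (ler_norm _).
  exists (- B) => y Ey; have [x _ [h1 h2]] := ae_dense (ae_and uB Ey) ltr01.
  by move: h1; rewrite ler_norml => /andP[h1 _]; exact: le_trans h2.
have SE s y : 0 <= s <= T -> E s y -> S s <= y.
  by move=> sT Ey; apply: ge_inf => //; case: (Einf s sT).
have ES s e : 0 <= s <= T -> 0 < e -> E s (S s + e).
  move=> sT e0; have [y Ey yS] := inf_adherent e0 (Einf s sT).
  by apply: ae_mono Ey => x h; rewrite (le_trans h)// ltW.
have ES0 s : 0 <= s <= T -> E s (S s).
  move=> sT; have [v [v1 [B [L [uv dv _ _ _]]]]] := reg s sT.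
  have cv : continuous v by move=> y; exact: is_derive_continuous (dv y).
  apply: (ae_mono _ uv) => x ->; apply/ler_addgt0Pr => e e0.
  apply: (@ae_continuous_le R v (fun=> S s + e)) => //; first by move=> z; exact: cvg_cst.
  by apply: ae_mono (ae_and uv (ES s e sT e0)) => y [<-].
(* Nearly maximal points exist inside any full-measure set [P]; otherwise [S s - e] would be an
   essential upper bound. *)
have {ES Einf} Snear s e : 0 <= s <= T -> 0 < e -> forall P : R -> Prop,
    {ae leb, forall x, P x} -> exists2 x, S s - e < u s x & P x.
  move=> sT e0 P aeP; apply: contrapT => H.
  suff : E s (S s - e) by move=> /(SE _ _ sT); lra.
  have [v [v1 [B [L [uv dv _ _ _]]]]] := reg s sT.
  have cv : continuous v by move=> y; exact: is_derive_continuous (dv y).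
  apply: ae_mono (ae_and uv aeP) => x [ux Px].
  by rewrite leNgt; apply/negP => Sx; apply: H; exists x.
have S0m : S 0 <= m by apply: SE => //; rewrite lexx.
suff St0 : S t <= S 0.
  by apply: ae_mono (ES0 t tT) => x /le_trans; apply; exact: le_trans S0m.
apply: (left_dini_nonincreasing (T := T)) tT => [s sT e e0|s /andP[s0 sT] e e0].
  have [d d0 H] := cont s sT e e0; exists d => // r rT rs.
  have ae_rs := H r rT rs; rewrite ler_norml; apply/andP; split.
    suff : S s <= S r + e by lra.
    apply: SE => //; apply: ae_mono (ae_and ae_rs (ES0 r rT)) => x [].
    by rewrite ler_norml; lra.
  suff : S r <= S s + e by lra.
  apply: SE => //; apply: ae_mono (ae_and ae_rs (ES0 s sT)) => x [].
  by rewrite ler_norml; lra.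
have s0T : 0 <= s <= T by rewrite ltW.
have e4 : 0 < e / 4 by rewrite divr_gt0.
have [d1 d10 H1] := velocity_near_max c0 (reg s s0T) e4 (ES0 s s0T).
have [d2 d20 H2] := diff s s0T _ e4.
exists d2 => // h /andP[h0 hd] hs.
have shT : 0 <= s - h <= T by lra.
have := H2 (- h); rewrite oppr_eq0 gt_eqF// normrN gtr0_norm// => /(_ isT hd shT) H2h.
(* The deficit at [x] must be below [d1] for the velocity bound and below [e / 4 * h] to be
   negligible at scale [h]. With [e / 4] for the velocity and [e / 4] for the difference quotient,
   the total is [3 / 4 * e * h]. *)
have dd0 : 0 < Num.min d1 (e / 4 * h) by rewrite lt_min d10 mulr_gt0.
have [x xS [[h1 h2] h3]] := Snear s _ s0T dd0 _ (ae_and (ae_and H1 H2h) (ES0 _ shT)).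
have dl1 : Num.min d1 (e / 4 * h) <= d1 by rewrite ge_min lexx.
have dl2 : Num.min d1 (e / 4 * h) <= e / 4 * h by rewrite ge_min lexx orbT.
have gx : g s x <= e / 4 by apply: h1; lra.
have : (u s x - u (s - h) x) / h <= e / 2.
  move: h2; rewrite ler_norml => /andP[_].
  have -> : (u (s - h) x - u s x) / - h = (u s x - u (s - h) x) / h.
    by field; rewrite gt_eqF.
  lra.
rewrite ler_pdivrMr//; lra.
Qed.

End one_sided_maximum_principle.

(** * From the [H^k] hypotheses to those of the maximum principle *)

Section Hk_profiles.
Variable R : realType.
Local Notation leb := (@lebesgue_measure R).

Lemma H1rep_small O k (D : nat -> R -> R) v (l : R) : (0 < k)%N -> 0 < l ->
  H1rep O (D 0%N) (D 1%N) v -> (Hk_normsq O k D <= (l ^+ 2)%:E)%E ->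
  {ae leb, forall x, `|D 0%N x| <= 3 * l}.
Proof.
move=> k0 l0 rep Dl.
have sup := H1rep_sup rep l0 (le_trans (Hk_term_le O D (leq0n k)) Dl)
  (le_trans (Hk_term_le O D k0) Dl).
by apply: (ae_mono _ (H1rep_ae rep)) => x ->.
Qed.

Lemma cvg_within_small (A : set R) (t : R) (N : R -> \bar R) (l : R) : 0 < l ->
  N @ within A (nbhs t) --> 0%E ->
  exists2 d, 0 < d & forall s, A s -> `|s - t| < d -> (N s <= (l ^+ 2)%:E)%E.
Proof.
move=> l0 cN.
have nb : nbhs (0%E : \bar R) [set y | (y < (l ^+ 2)%:E)%E].
  apply: open_nbhs_nbhs; split; first exact: open_ereal_lt_ereal.
  by rewrite /= lte_fin exprn_gt0.
have [d /= d0 H] := cN _ nb.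
exists d => // s As st; apply: ltW; apply: (H s) => //.
by rewrite /= distrC.
Qed.

(** For almost every [x] the values at [x] agree, and for almost every [a] so do those at [x - a];
    the two kernels then have the same truncated integrals. *)
Lemma muskat_pv_to_ae c (w wx v v1 : R -> R) (g : R -> R) :
  measurable_fun [set: R] w -> measurable_fun [set: R] wx ->
  measurable_fun [set: R] v -> measurable_fun [set: R] v1 ->
  {ae leb, forall x, w x = v x /\ wx x = v1 x} ->
  {ae leb, forall x, muskat_pv_to c w wx x (g x)} ->
  {ae leb, forall x, muskat_pv_to c v v1 x (g x)}.
Proof.
move=> mw mwx mv mv1 wv pv; apply: (ae_mono _ (ae_and wv pv)) => x [[wx_ wxx]].
rewrite /muskat_pv_to.
have -> // : (fun M => c * Rintegral leb `[- M, M]%classic (muskat_kernel w wx x)) =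
  (fun M => c * Rintegral leb `[- M, M]%classic (muskat_kernel v v1 x)).
apply/funext => M; congr (c * fine _); apply: ae_eq_integral => //.
- apply/measurable_EFinP; apply: (@measurable_funS _ _ _ _ setT) => //.
  exact: muskat_kernel_measurable.
- apply/measurable_EFinP; apply: (@measurable_funS _ _ _ _ setT) => //.
  exact: muskat_kernel_measurable.
- apply: (ae_mono _ (ae_reflect x wv)) => a /= [ha hb] _.
  by rewrite /muskat_kernel ha hb wx_ wxx.
Qed.

Lemma in_Hk_regular_profile O k c g (gs : nat -> R -> R) (gt : R -> R) :
  (3 <= k)%N -> in_Hk O k g gs ->
  {ae leb, forall x, muskat_pv_to c g (gs 1%N) x (gt x)} ->
  regular_profile c g gt.
Proof.
move=> k3 Hg pv; have [v [v1 [B [L [gv dv v1L vB]]]]] := in_Hk_C11 k3 Hg.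
have [g0 mO _ _] := Hg.
have [m0 _] := mO 0%N isT; have [m1 _] := mO 1%N (leq_trans (isT : (1 <= 3)%N) k3).
exists v, v1, B, L; split => //.
  by apply: (ae_mono _ gv) => x [].
apply: muskat_pv_to_ae gv pv => //; first by rewrite -g0.
- by apply: continuous_measurable_fun => y; exact: is_derive_continuous (dv y).
- by apply: continuous_measurable_fun; exact: lipschitz_continuous1 v1L.
Qed.

End Hk_profiles.

(** [H1rep_sup] turns the [H^k] limits in time into bounds uniform in [x]; the one-sided principle
    is then applied to [f] and to [- f]. *)
Lemma C1_Hk_le (R : realType) (O : domain) (k : nat) (c T : R) (f : R -> R -> R)
    (F G : R -> nat -> R -> R) :
  (3 <= k)%N -> 0 <= c -> C1_Hk O k T f F G ->
  (forall t, 0 <= t <= T -> {ae (@lebesgue_measure R), forall x,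
     muskat_pv_to c (fun y => f y t) (F t 1%N) x (G t 0%N x)}) ->
  forall m t, 0 <= t <= T ->
  {ae (@lebesgue_measure R), forall x, `|f x 0| <= m} ->
  {ae (@lebesgue_measure R), forall x, `|f x t| <= m}.
Proof.
move=> k3 c0 [HF HG cF dF _] pv m t tT f0m.
have k0 : (0 < k)%N by exact: leq_trans k3.
have F0 s : 0 <= s <= T -> F s 0%N = fun x => f x s by move=> /HF [].
have cont s : 0 <= s <= T -> forall e, 0 < e -> exists2 d, 0 < d &
    forall r, 0 <= r <= T -> `|r - s| < d ->
      {ae (@lebesgue_measure R), forall x, `|f x r - f x s| <= e}.
  move=> sT e e0; have e30 : 0 < e / 3 by rewrite divr_gt0.
  have e3E : 3 * (e / 3) = e by lra.
  have [d d0 H] := cvg_within_small e30 (cF s sT).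
  exists d => // r rT rs.
  have [vr repr] := in_Hk_rep (HF r rT) k0.
  have [vs reps] := in_Hk_rep (HF s sT) k0.
  have rep := H1rep_lin 1 (- 1) repr reps.
  have linE (a b : R -> R) : (fun x => 1 * a x + - 1 * b x) = (fun x => a x - b x).
    by apply/funext => x; rewrite mul1r mulN1r.
  rewrite !linE in rep.
  have := H1rep_small (D := fun j x => F r j x - F s j x) k0 e30 rep (H r rT rs).
  by apply: ae_mono => x; rewrite (F0 _ rT) (F0 _ sT) e3E.
have diff s : 0 <= s <= T -> forall e, 0 < e -> exists2 d, 0 < d &
    forall h, h != 0 -> `|h| < d -> 0 <= s + h <= T ->
      {ae (@lebesgue_measure R), forall x, `|(f x (s + h) - f x s) / h - G s 0%N x| <= e}.
  move=> sT e e0; have e30 : 0 < e / 3 by rewrite divr_gt0.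
  have e3E : 3 * (e / 3) = e by lra.
  have [d d0 H] := cvg_within_small e30 (dF s sT).
  exists d => // h h0 hd rT.
  have [vr repr] := in_Hk_rep (HF _ rT) k0.
  have [vs reps] := in_Hk_rep (HF s sT) k0.
  have [vg repg] := in_Hk_rep (HG s sT) k0.
  have rep := H1rep_lin 1 (- 1) (H1rep_lin h^-1 (- h^-1) repr reps) repg.
  have linE (a b b' : R -> R) : (fun x => 1 * (h^-1 * a x + - h^-1 * b x) + - 1 * b' x) =
      (fun x => (a x - b x) / h - b' x).
    by apply/funext => x; ring.
  rewrite !linE in rep.
  have := H1rep_small (D := fun j x => (F (s + h) j x - F s j x) / h - G s j x) k0 e30 rep.
  have hd0 : `|h - 0| < d by rewrite subr0.
  move=> /(_ (H h (conj rT h0) hd0)).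
  by apply: ae_mono => x; rewrite (F0 _ rT) (F0 _ sT) e3E.
have reg s : 0 <= s <= T -> regular_profile c (fun x => f x s) (G s 0%N).
  by move=> sT; exact: in_Hk_regular_profile k3 (HF s sT) (pv s sT).
have up : {ae (@lebesgue_measure R), forall x, f x t <= m}.
  apply: (one_sided_maximum_principle (u := fun t x => f x t) c0 reg cont diff _ tT).
  by apply: (ae_mono _ f0m) => x; exact: le_trans (ler_norm _).
have down : {ae (@lebesgue_measure R), forall x, - f x t <= m}.
  apply: (one_sided_maximum_principle (u := fun t x => - f x t) (g := fun t x => - G t 0%N x)
    c0 _ _ _ _ tT).
  - by move=> s sT; apply: regular_profileN; exact: reg.
  - move=> s sT e e0; have [d d0 H] := cont s sT e e0; exists d => // r rT rs.
    by apply: (ae_mono _ (H r rT rs)) => x; rewrite -opprD normrN.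
  - move=> s sT e e0; have [d d0 H] := diff s sT e e0; exists d => // h h0 hd rT.
    apply: (ae_mono _ (H h h0 hd rT)) => x.
    by rewrite -opprD mulNr -opprD normrN.
  - by apply: (ae_mono _ f0m) => x h; rewrite (le_trans _ h)// -normrN ler_norm.
by apply: (ae_mono _ (ae_and up down)) => x [h1 h2]; rewrite ler_norml lerNl h2.
Qed.

Unset Implicit Arguments.

Theorem theorem3p1 (R : realType) (O : domain) (k : nat) (rho1 rho2 T : R)
  (f0 : R -> R) (f : R -> R -> R) (F G : R -> nat -> R -> R) :
  (3 <= k)%N -> 0 <= rho1 -> rho1 < rho2 ->
  (exists gs, in_Hk O k f0 gs) ->
  0 < T ->
  C1_Hk O k T f F G ->
  (* the interface equation, with f_t(.,t) = G t 0 *)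
  (forall t, 0 <= t <= T ->
     {ae (@lebesgue_measure R), forall x,
        muskat_pv_to ((rho2 - rho1) / (2 * pi)) (fun y => f y t) (F t 1%N) x
          (G t 0%N x)}) ->
  (* initial datum *)
  {ae (@lebesgue_measure R), forall x, f x 0 = f0 x} ->
  forall t, 0 <= t <= T ->
    (ess_sup (@lebesgue_measure R) (fun x => (`|f x t|)%:E)
     <= ess_sup (@lebesgue_measure R) (fun x => (`|f0 x|)%:E))%E.
Proof.
move=> k3 _ rho12 _ _ C1 pv init t tT.
have c0 : 0 <= (rho2 - rho1) / (2 * pi).
  by rewrite divr_ge0 ?subr_ge0 ?(ltW rho12)// mulr_ge0// pi_ge0.
have f0_le : {ae (@lebesgue_measure R), forall x,
    (`|f0 x|%:E <= ess_sup (@lebesgue_measure R) (fun x => `|f0 x|%:E))%E}.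
  exact: ess_sup_ge.
(* The value [-oo] is excluded because a full-measure set contains a point, where [|f0 x| <= -oo]
   fails. *)
case: (ess_sup (@lebesgue_measure R) (fun x => `|f0 x|%:E)) f0_le => [m| |] f0_le.
- apply/ess_supP; apply: (C1_Hk_le k3 c0 C1 pv tT).
  by apply: (ae_mono _ (ae_and f0_le init)) => x []; rewrite lee_fin => h ->.
- exact: leey.
- by have [x _] := ae_dense f0_le ltr01.
Qed.
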